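(* Let $X$ and $Y$ be Banach spaces such that: (i) $X$ is separable; (ii) $X^*$ and $Y$ have the Near Radon-Nikodym property; (iii) $L(X,Y)=K(X,Y)$. Then $K(X,Y)$ has the Near Radon-Nikodym property.
   Context: $L(X,Y)$ (resp. $K(X,Y)$) denotes the Banach space of all bounded (resp. compact) linear operators from $X$ into $Y$. A bounded linear operator $T:L^1[0,1]\to E$ ($E$ a Banach space) is (Bochner) representable if there is $g\in L^\infty([0,1],E)$ with $T(f)=\int_0^1 f g\,dt$ (Bochner integral) for all $f\in L^1[0,1]$. A bounded linear operator $D:L^1[0,1]\to E$ is a Dunford-Pettis operator if it sends weakly compact sets into norm compact sets. A bounded linear operator $T:L^1[0,1]\to E$ is nearly representable if $T\circ D$ is representable for every Dunford-Pettis operator $D:L^1[0,1]\to L^1[0,1]$. A Banach space $E$ has the Near Radon-Nikodym property (NearRNP) if every nearly representable operator from $L^1[0,1]$ into $E$ is representable. *)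

(* Defs.v *)
From HB Require Import structures.
From mathcomp Require Import all_boot all_order all_algebra finmap.
From mathcomp Require Import all_classical all_reals all_analysis.
From mathcomp Require Import measurable_realfun ess_sup_inf lra.

Set Implicit Arguments.
Unset Strict Implicit.
Unset Printing Implicit Defensive.
Import Order.TTheory GRing.Theory Num.Theory.
Import numFieldNormedType.Exports.

Local Open Scope classical_set_scope.
Local Open Scope ring_scope.

Section bounded_op.
Context {R : realType} {X Y : normedModType R}.
Implicit Types f g : X -> Y.

Definition is_bounded_op : {pred X -> Y} :=
  [pred f | `[< linear f /\ exists M : R, forall x, `|f x| <= M * `|x| >]].

Lemma is_bounded_opP f : reflect
  (linear f /\ exists M : R, forall x, `|f x| <= M * `|x|) (f \in is_bounded_op).
Proof. exact: asboolP. Qed.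

Lemma is_bounded_op_submod_closed : submod_closed is_bounded_op.
Proof.
split.
  apply/is_bounded_opP; split; first by move=> a x y; rewrite /= scaler0 addr0.
  by exists 0 => x; rewrite normr0 mul0r.
move=> a f g /is_bounded_opP[lf [M Mf]] /is_bounded_opP[lg [N Ng]].
apply/is_bounded_opP; split.
  move=> b x y; rewrite !fctE lf lg !scalerDr !scalerA (mulrC a b).
  by rewrite addrACA.
exists (`|a| * M + N) => x; rewrite !fctE.
rewrite (le_trans (ler_normD _ _))// mulrDl lerD//.
by rewrite normrZ -mulrA ler_wpM2l.
Qed.

HB.instance Definition _ := GRing.isSubmodClosed.Build _ _ is_bounded_op
  is_bounded_op_submod_closed.

(* L(X, Y), equipped below with the operator norm. *)
Record bounded_op := BoundedOp {
  bounded_op_fun :> X -> Y ;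
  _ : bounded_op_fun \in is_bounded_op }.

HB.instance Definition _ := [isSub of bounded_op for bounded_op_fun].
HB.instance Definition _ := [Choice of bounded_op by <:].
HB.instance Definition _ := [SubChoice_isSubLmodule of bounded_op by <:].

Lemma bounded_op_linear (T : bounded_op) : linear T.
Proof. by have /is_bounded_opP[] := valP T. Qed.

HB.instance Definition _ (T : bounded_op) :=
  GRing.isLinear.Build R X Y _ T (bounded_op_linear T).

Lemma bounded_op_ex (T : bounded_op) : exists M : R, forall x, `|T x| <= M * `|x|.
Proof. by have /is_bounded_opP[] := valP T. Qed.

Lemma bounded_opP (S T : bounded_op) : S =1 T -> S = T.
Proof. by move=> ST; apply/val_inj/funext. Qed.

Definition opnorm (T : bounded_op) : R :=
  sup [set `|T x| | x in [set x | `|x| <= 1]].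

Lemma opnorm_has_sup (T : bounded_op) :
  has_sup [set `|T x| | x in [set x | `|x| <= 1]].
Proof.
split; first by exists `|T 0|, 0 => //=; rewrite normr0.
have [M MT] := bounded_op_ex T.
exists `|M| => _ [x /= x1 <-].
rewrite (le_trans (MT x))// (le_trans (ler_norm _))// normrM normr_id.
by rewrite ler_piMr.
Qed.

Lemma le_opnorm (T : bounded_op) x : `|T x| <= opnorm T * `|x|.
Proof.
have [->|x0] := eqVneq x 0; first by rewrite linear0 !normr0 mulr0.
have nx0 : 0 < `|x| by rewrite normr_gt0.
rewrite -ler_pdivrMr//.
have -> : `|T x| / `|x| = `|T (`|x|^-1 *: x)|.
  by rewrite linearZ normrZ ger0_norm ?invr_ge0// mulrC.
apply: (sup_upper_bound (opnorm_has_sup T)); exists (`|x|^-1 *: x) => //=.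
by rewrite normrZ ger0_norm ?invr_ge0// mulVf ?gt_eqF.
Qed.

Lemma opnorm_le (T : bounded_op) M : 0 <= M ->
  (forall x, `|T x| <= M * `|x|) -> opnorm T <= M.
Proof.
move=> M0 MT; apply: ge_sup; first exact: (opnorm_has_sup T).1.
by move=> _ [x /= x1 <-]; rewrite (le_trans (MT x))// ler_piMr.
Qed.

Lemma opnorm_ge0 (T : bounded_op) : 0 <= opnorm T.
Proof.
apply: (sup_upper_bound (opnorm_has_sup T)); exists 0; first by rewrite /= normr0.
by rewrite linear0 normr0.
Qed.

Lemma opnormD (S T : bounded_op) : opnorm (S + T) <= opnorm S + opnorm T.
Proof.
apply: opnorm_le => [|x]; first by rewrite addr_ge0 ?opnorm_ge0.
by rewrite (le_trans (ler_normD _ _))// mulrDl lerD// le_opnorm.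
Qed.

Let opnormZ_le (a : R) (T : bounded_op) : opnorm (a *: T) <= `|a| * opnorm T.
Proof.
apply: opnorm_le => [|x]; first by rewrite mulr_ge0 ?opnorm_ge0.
by rewrite [X in `|X|]/(a *: T x) normrZ -mulrA ler_wpM2l// le_opnorm.
Qed.

Lemma opnormZ (a : R) (T : bounded_op) : opnorm (a *: T) = `|a| * opnorm T.
Proof.
apply/eqP; rewrite eq_le opnormZ_le/=.
have [->|a0] := eqVneq a 0; first by rewrite normr0 mul0r opnorm_ge0.
rewrite -ler_pdivlMl ?normr_gt0// -normfV.
by rewrite -[X in opnorm X](scalerK a0) opnormZ_le.
Qed.

Lemma opnorm0_eq0 (T : bounded_op) : opnorm T = 0 -> T = 0.
Proof.
move=> T0; apply: bounded_opP => x; apply/eqP; rewrite -normr_le0.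
by rewrite (le_trans (le_opnorm T x))// T0 mul0r.
Qed.

HB.instance Definition _ := Lmodule_isNormed.Build R bounded_op
  opnormD opnormZ opnorm0_eq0.

Lemma opnormE (T : bounded_op) : `|T| = opnorm T. Proof. by []. Qed.

Lemma ler_opnorm (T : bounded_op) x : `|T x| <= `|T| * `|x|.
Proof. exact: le_opnorm. Qed.

Lemma bounded_op_continuous (T : bounded_op) : continuous T.
Proof.
apply: bounded_linear_continuous; apply/linear_boundedP.
have [M MT] := bounded_op_ex T; near=> r => x.
by rewrite (le_trans (MT x))// ler_wpM2r.
Unshelve. all: by end_near. Qed.

End bounded_op.
Arguments bounded_op {R} X Y.

Section bounded_op_complete.
Context {R : realType} {X : normedModType R} {Y : completeNormedModType R}.

Lemma bounded_op_complete (F : set_system (bounded_op X Y)) :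
  ProperFilter F -> cauchy F -> cvg F.
Proof.
move=> FF /cauchyP Fc; apply/cvg_ex.
have FC e : 0 < e -> exists S : bounded_op X Y,
    \forall T \near F, `|S - T| < e /\ forall x, `|S x - T x| <= e * `|x|.
  move=> e0; have [S FS] := Fc e e0; exists S; apply: filterS FS => T.
  rewrite -ball_normE /= => ST; split=> // x.
  by rewrite (le_trans (ler_opnorm (S - T) x))// ler_wpM2r// ltW.
have cvx x : cvg ((fun T : bounded_op X Y => T x) @ F).
  apply: cauchy_cvg; apply/cauchyP => e e0.
  have d0 : 0 < e / (`|x| + 1) by rewrite divr_gt0 ?ltr_wpDl.
  have [S FS] := FC _ d0; exists (S x); apply: filterS FS => T [_ /(_ x) ST].
  rewrite -ball_normE /= (le_lt_trans ST)// -mulrA gtr_pMr// mulrC.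
  by rewrite ltr_pdivrMr ?ltr_wpDl// mul1r ltrDl.
pose g x : Y := lim ((fun T : bounded_op X Y => T x) @ F).
have gx x : (fun T : bounded_op X Y => T x) @ F --> g x by exact: cvx.
have gd e : 0 < e -> exists S : bounded_op X Y, (\forall T \near F, `|S - T| < e) /\
    forall x, `|S x - g x| <= e * `|x|.
  move=> e0; have [S FS] := FC _ e0; exists S; split.
    by apply: filterS FS => T [].
  move=> x; have : (fun T : bounded_op X Y => `|S x - T x|) @ F --> `|S x - g x|.
    by apply: cvg_norm; apply: cvgB; [exact: cvg_cst|exact: gx].
  apply: (@closed_cvg _ _ F _ _ (fun y => y <= e * `|x|)).
    exact: closed_le.
  by apply: filterS FS => T [].
have glin : linear g.
  move=> a x y; apply: (cvg_unique _ (gx (a *: x + y))); first exact: norm_hausdorff.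
  have -> : (fun T : bounded_op X Y => T (a *: x + y)) = (fun T => a *: T x + T y).
    by apply/funext => T; rewrite bounded_op_linear.
  by apply: cvgD; [apply: cvgZr; exact: gx|exact: gx].
have gP : g \in is_bounded_op.
  apply/is_bounded_opP; split=> //.
  have [S [_ Sg]] := gd _ (@ltr01 R); exists (`|S| + 1) => x.
  have -> : g x = S x - (S x - g x) by rewrite subKr.
  by rewrite (le_trans (ler_normB _ _))// mulrDl lerD// ler_opnorm.
exists (BoundedOp gP); apply/cvgrPdist_le => e e0.
have e20 : 0 < e / 2 by rewrite divr_gt0.
have [S [FS Sg]] := gd _ e20; apply: filterS FS => T ST.
rewrite -(subrKA S) [e]splitr (le_trans (ler_normD _ _))// lerD//; last exact: ltW.
rewrite opnormE; apply: opnorm_le => [|x]; first exact: ltW.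
by rewrite [X in `|X|]/(g x - S x) distrC.
Qed.

HB.instance Definition _ := Uniform_isComplete.Build (bounded_op X Y)
  bounded_op_complete.

End bounded_op_complete.

Section compact_op.
Context {R : realType} {X Y : normedModType R}.

Definition is_compact_op : {pred bounded_op X Y} :=
  [pred T : bounded_op X Y | `[< precompact (T @` [set x | `|x| <= 1]) >]].

Lemma is_compact_opP (T : bounded_op X Y) :
  reflect (precompact (T @` [set x | `|x| <= 1])) (T \in is_compact_op).
Proof. exact: asboolP. Qed.

Lemma is_compact_op_submod_closed : submod_closed is_compact_op.
Proof.
have hY : hausdorff_space Y by exact: norm_hausdorff.
split.
  apply/is_compact_opP; exists [set 0]; first by move=> _ [x _ <-].
  by split; [exact: compact_set1|exact/accessible_closed_set1/hausdorff_accessible].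
move=> a S T /is_compact_opP[K SK [cK _]] /is_compact_opP[L TL [cL _]].
apply/is_compact_opP.
pose f (z : Y * Y) := a *: z.1 + z.2.
have cf : continuous f.
  move=> z; apply: cvgD; last exact: cvg_snd.
  by apply: cvgZr; exact: cvg_fst.
have cKL : compact (f @` (K `*` L)).
  apply: continuous_compact; last exact: compact_setX.
  exact: continuous_subspaceT.
exists (f @` (K `*` L)); last by split=> //; exact: compact_closed.
move=> _ [x /= x1 <-]; exists (S x, T x) => //=.
by split; [apply: SK|apply: TL]; exists x.
Qed.

HB.instance Definition _ := GRing.isSubmodClosed.Build _ _ is_compact_op
  is_compact_op_submod_closed.

(* K(X, Y), with the operator norm inherited from bounded_op X Y. *)
Record compact_op := CompactOp {
  compact_op_val :> bounded_op X Y ;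
  _ : compact_op_val \in is_compact_op }.

HB.instance Definition _ := [isSub of compact_op for compact_op_val].
HB.instance Definition _ := [Choice of compact_op by <:].
HB.instance Definition _ := [SubChoice_isSubLmodule of compact_op by <:].

Let norm (T : compact_op) : R := `|compact_op_val T|.

Let normD (S T : compact_op) : norm (S + T) <= norm S + norm T.
Proof. exact: ler_normD. Qed.

Let normZ a (T : compact_op) : norm (a *: T) = `|a| * norm T.
Proof. exact: normrZ. Qed.

Let norm0_eq0 (T : compact_op) : norm T = 0 -> T = 0.
Proof. by move=> /normr0_eq0 T0; exact: val_inj. Qed.

HB.instance Definition _ := Lmodule_isNormed.Build R compact_op
  normD normZ norm0_eq0.

Lemma compact_op_normE (T : compact_op) : `|T| = `|compact_op_val T|.
Proof. by []. Qed.

End compact_op.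
Arguments compact_op {R} X Y.

Section compact_op_complete.
Context {R : realType} {X : normedModType R} {Y : completeNormedModType R}.

Lemma ultra_bigU T (I : choiceType) (D : {fset I}) (f : I -> set T)
    (F : set_system T) : UltraFilter F -> F (\bigcup_(i in [set` D]) f i) ->
  exists2 i, i \in D & F (f i).
Proof.
move=> UF FD; apply: contrapT => nF.
have : F (\bigcap_(i in [set` D]) ~` f i).
  apply: filter_bigI => i iD; have [Ffi|//] := in_ultra_setVsetC (f i) UF.
  by exfalso; apply: nF; exists i.
rewrite -setC_bigcup => FC; have [] := @filter_not_empty _ F _.
by rewrite -(setICr (\bigcup_(i in [set` D]) f i)); exact: filterI.
Qed.

Lemma is_compact_op_closed (T : bounded_op X Y) :
  (forall e, 0 < e -> exists2 S, S \in is_compact_op & `|S - T| < e) ->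
  T \in is_compact_op.
Proof.
move=> ST; apply/is_compact_opP; rewrite precompactE compact_ultra => G UG Gcl.
have : cvg G.
  apply: cauchy_cvg; apply/cauchyP => e e0.
  have e40 : 0 < e / 4 by rewrite divr_gt0.
  have [S /is_compact_opP[K SK [cK _]] STe] := ST _ e40.
  move: cK; rewrite compact_cover => /(_ Y K (fun z => ball z (e / 4))).
  case=> [z _|z Kz|D DK KD]; first exact: ball_open.
    by exists z => //; exact: ballxx.
  suff : G (\bigcup_(z in [set` D]) ball z e).
    by move=> /ultra_bigU[z zD Gz]; exists z.
  apply: filterS Gcl => y /(_ _ (nbhsx_ballx y _ e40))[_ [[x /= x1 <-] yTx]].
  have /KD[z zD zSx] : K (S x) by apply: SK; exists x.
  exists z => //; rewrite -ball_normE /=.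
  move: yTx zSx; rewrite -!ball_normE /= => yTx zSx.
  have SxTx : `|S x - T x| < e / 4.
    rewrite (le_lt_trans (ler_opnorm (S - T) x))// (le_lt_trans _ STe)//.
    by rewrite ler_piMr.
  have -> : z - y = (z - S x) + (S x - T x) + (T x - y).
    by rewrite -[z - S x + _]addrA !addrA !subrK.
  rewrite (le_lt_trans (ler_normD _ _))//.
  rewrite (le_lt_trans (lerD (ler_normD _ _) (lexx _)))// (distrC (T x)).
  have : `|z - S x| + `|S x - T x| + `|y - T x| < e / 4 + e / 4 + e / 4.
    by rewrite !ltrD.
  by move/lt_le_trans; apply; lra.
move=> /cvg_ex[y Gy]; exists y; split=> //.
by apply: (@closed_cvg _ _ G _ id _ (@closed_closure _ _)).
Qed.

Lemma compact_op_complete (F : set_system (compact_op X Y)) :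
  ProperFilter F -> cauchy F -> cvg F.
Proof.
move=> FF /cauchyP Fc; apply/cvg_ex.
have : cvg (compact_op_val @ F).
  apply: cauchy_cvg; apply/cauchyP => e e0; have [S FS] := Fc e e0.
  exists (compact_op_val S); apply: filterS FS => T; rewrite -!ball_normE; exact.
move=> /cvg_ex[T FT].
have TK : T \in is_compact_op.
  apply: is_compact_op_closed => e e0.
  have /cvgrPdist_lt/(_ e e0)/filter_ex[S TS] := FT.
  by exists S; [exact: valP|rewrite distrC].
exists (CompactOp TK); apply/cvgrPdist_lt => e e0.
by have /cvgrPdist_lt/(_ e e0) := FT; apply: filterS.
Qed.

HB.instance Definition _ := Uniform_isComplete.Build (compact_op X Y)
  compact_op_complete.

End compact_op_complete.

(* LspaceType mu p1 is the set of classes of measurable functions with finite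
   p-norm modulo equality mu-a.e.; it is equipped here with its normed space
   structure. An element coerces to a representative of its class. *)
Section Lspace_structure.
Context d (T : measurableType d) (R : realType).
Variables (mu : {measure set T -> \bar R}) (p : \bar R) (p1 : (1 <= p)%E).
Implicit Types f g h : T -> R.
Implicit Types u v w : LspaceType mu p1.

Lemma ae_eq_Lnorm f g :
  measurable_fun setT f -> measurable_fun setT g -> f = g %[ae mu] ->
  ('N[mu]_p[EFin \o f] = 'N[mu]_p[EFin \o g])%E.
Proof.
move=> mf mg fg; rewrite unlock; case: p p1 => [r r1| _ |//].
  congr (_ `^ _)%E; apply: ae_eq_integral => //.
  - by apply/measurable_EFinP; apply: (measurableT_comp (measurable_powR _));
      exact: measurableT_comp.
  - by apply/measurable_EFinP; apply: (measurableT_comp (measurable_powR _));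
      exact: measurableT_comp.
  - by apply: filterS fg => x /(_ I) /= -> .
case: ifPn => // mu0; apply: eq_ess_sup.
by apply: filterS fg => x /(_ I) /= ->.
Qed.

Lemma Lspace_mfun u : measurable_fun setT (u : T -> R).
Proof. exact: (@measurable_funPT _ _ _ _ (repr (LebesgueSpace.sort u))). Qed.

Lemma Lspace_Lfun u : (u : T -> R) \in Lfun mu p.
Proof.
rewrite inE; apply/andP; split.
  exact/mem_set/Lspace_mfun.
exact/mem_set/Lebesgue_finite.
Qed.

Lemma Lspace_eqP u v : u = v <-> (u : T -> R) = v %[ae mu].
Proof.
split=> [->|uv]; first exact: ae_eq_refl.
have : LebesgueSpace.sort u = LebesgueSpace.sort v.
  rewrite -(reprK (LebesgueSpace.sort u)) -(reprK (LebesgueSpace.sort v)).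
  by apply/eqquotP; apply/asboolP.
case: u v {uv} => [u [[uf]]] [v [[vf]]] /= uv.
by move: uf vf; rewrite uv => uf vf; rewrite (Prop_irrelevance uf vf).
Qed.

Let mfunR (f : LfunType mu p1) : {mfun T >-> measurableTypeR R} :=
  HB.pack (f : T -> measurableTypeR R)
    (isMeasurableFun.Build d _ T (measurableTypeR R) f (@measurable_funPT _ _ _ _ f)).

Let pi_mfun (f : LfunType mu p1) : {mfun_ mu, T >-> measurableTypeR R} :=
  \pi_({mfun_ mu, T >-> measurableTypeR R})%qT (mfunR f).

Let pi_mfunE (f : LfunType mu p1) : (pi_mfun f : T -> R) = f %[ae mu].
Proof.
by apply/asboolP; rewrite -[asbool _]/(ae_eq_op mu (repr (pi_mfun f)) (mfunR f));
  apply/eqquotP; exact: (reprK (pi_mfun f)).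
Qed.

Let pi_mfun_finite (f : LfunType mu p1) : finite_norm mu p (pi_mfun f).
Proof.
have mpi : measurable_fun setT (pi_mfun f : T -> R).
  exact: (@measurable_funPT _ _ _ _ (repr (pi_mfun f))).
by rewrite /finite_norm (ae_eq_Lnorm mpi _ (pi_mfunE f))//; exact: (Lfunction_finite p1 f).
Qed.

Definition Lspace_of (f : LfunType mu p1) : LspaceType mu p1 :=
  LebesgueSpace.pack_ (isFinLebesgue.Build d T R mu p p1 (pi_mfun f) (pi_mfun_finite f)).

Lemma Lspace_ofE (f : LfunType mu p1) : (Lspace_of f : T -> R) = f %[ae mu].
Proof. exact: pi_mfunE. Qed.

Definition Lspace_repr u : LfunType mu p1 := Lfun_Sub p1 (Lspace_Lfun u).

Lemma Lspace_of_repr u : Lspace_of (Lspace_repr u) = u.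
Proof. by apply/Lspace_eqP; exact: Lspace_ofE. Qed.

HB.instance Definition _ := gen_eqMixin (LspaceType mu p1).
HB.instance Definition _ := gen_choiceMixin (LspaceType mu p1).

Let zero := Lspace_of 0.
Let opp u := Lspace_of (- Lspace_repr u).
Let add u v := Lspace_of (Lspace_repr u + Lspace_repr v).
Let scale (a : R) u := Lspace_of (a *: Lspace_repr u).

Let zeroE : (zero : T -> R) = cst 0 %[ae mu].
Proof. exact: Lspace_ofE. Qed.

Let oppE u : (opp u : T -> R) = (fun x => - (u x : R)) %[ae mu].
Proof. exact: Lspace_ofE. Qed.

Let addE u v : (add u v : T -> R) = (fun x => (u x : R) + v x) %[ae mu].
Proof. exact: Lspace_ofE. Qed.

Let scaleE (a : R) u : (scale a u : T -> R) = (fun x => a * u x) %[ae mu].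
Proof. exact: Lspace_ofE. Qed.

Let ae_and (P Q : T -> Prop) : (\forall x \ae mu, P x) ->
  (\forall x \ae mu, Q x) -> \forall x \ae mu, P x /\ Q x.
Proof. by move=> muP muQ; apply: filterS2 muP muQ => x; split. Qed.

Let addA : associative add.
Proof.
move=> u v w; apply/Lspace_eqP.
have [H1 H2] := (ae_and (addE u (add v w)) (addE v w),
                 ae_and (addE (add u v) w) (addE u v)).
apply: filterS2 H1 H2 => x [/(_ I) /= -> /(_ I) /= ->] [/(_ I) /= -> /(_ I) /= ->] _.
by rewrite addrA.
Qed.

Let addC : commutative add.
Proof.
move=> u v; apply/Lspace_eqP; move: (addE u v) (addE v u).
by apply: filterS2 => x /(_ I) /= -> /(_ I) /= -> _; rewrite addrC.
Qed.

Let add0 : left_id zero add.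
Proof.
move=> u; apply/Lspace_eqP; move: (addE zero u) zeroE.
by apply: filterS2 => x /(_ I) /= -> /(_ I) /= -> _; rewrite add0r.
Qed.

Let addN : left_inverse zero opp add.
Proof.
move=> u; apply/Lspace_eqP; move: (addE (opp u) u) (oppE u) zeroE.
by apply: filterS3 => x /(_ I) /= -> /(_ I) /= -> /(_ I) /= -> _; rewrite addNr.
Qed.

HB.instance Definition _ := GRing.isZmodule.Build (LspaceType mu p1)
  addA addC add0 addN.

Let scaleA a b u : scale a (scale b u) = scale (a * b) u.
Proof.
apply/Lspace_eqP; move: (scaleE a (scale b u)) (scaleE b u) (scaleE (a * b) u).
by apply: filterS3 => x /(_ I) /= -> /(_ I) /= -> /(_ I) /= -> _; rewrite mulrA.
Qed.

Let scale1 : left_id 1 scale.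
Proof.
move=> u; apply/Lspace_eqP; move: (scaleE 1 u).
by apply: filterS => x /(_ I) /= -> _; rewrite mul1r.
Qed.

Let scaleDr : right_distributive scale +%R.
Proof.
move=> a u v; apply/Lspace_eqP.
have H := ae_and (scaleE a (u + v)) (addE u v).
have H' := ae_and (scaleE a u) (scaleE a v).
move: H (addE (scale a u) (scale a v)) H'.
apply: filterS3 => x [/(_ I) /= -> /(_ I) /= ->] /(_ I) /= ->.
by move=> [/(_ I) /= -> /(_ I) /= ->] _; rewrite mulrDr.
Qed.

Let scaleDl u : {morph scale^~ u : a b / a + b}.
Proof.
move=> a b; apply/Lspace_eqP.
have H := ae_and (scaleE a u) (scaleE b u).
move: (scaleE (a + b) u) (addE (scale a u) (scale b u)) H.
apply: filterS3 => x /(_ I) /= -> /(_ I) /= ->.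
by move=> [/(_ I) /= -> /(_ I) /= ->] _; rewrite mulrDl.
Qed.

HB.instance Definition _ := GRing.Zmodule_isLmodule.Build R (LspaceType mu p1)
  scaleA scale1 scaleDr scaleDl.

Lemma Lspace_zeroE : ((0 : LspaceType mu p1) : T -> R) = cst 0 %[ae mu].
Proof. exact: zeroE. Qed.

Lemma Lspace_addE u v : (u + v : T -> R) = (fun x => (u x : R) + v x) %[ae mu].
Proof. exact: addE. Qed.

Lemma Lspace_scaleE (a : R) u : (a *: u : T -> R) = (fun x => a * u x) %[ae mu].
Proof. exact: scaleE. Qed.

Definition Lspace_norm u : R := fine ('N[mu]_p[EFin \o (u : T -> R)])%E.

Let normE u (f : LfunType mu p1) : (u : T -> R) = f %[ae mu] ->
  Lspace_norm u = fine ('N[mu]_p[EFin \o f])%E.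
Proof. by move=> uf; rewrite /Lspace_norm (ae_eq_Lnorm _ _ uf)//; exact: Lspace_mfun. Qed.

Let normD u v : Lspace_norm (u + v) <= Lspace_norm u + Lspace_norm v.
Proof.
rewrite (normE (Lspace_addE u v : _ = (Lspace_repr u + Lspace_repr v : LfunType mu p1) %[ae mu])).
exact: (ler_LnormD (Lspace_repr u) (Lspace_repr v)).
Qed.

Let normZ (a : R) u : Lspace_norm (a *: u) = `|a| * Lspace_norm u.
Proof.
rewrite (normE (Lspace_scaleE a u : _ = (a *: Lspace_repr u : LfunType mu p1) %[ae mu])).
apply/EFin_inj; rewrite finite_norm_fine LnormZ EFinM; congr (_ * _)%E.
by rewrite -(finite_norm_fine (Lspace_repr u)).
Qed.

Let norm0_eq0 u : Lspace_norm u = 0 -> u = 0.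
Proof.
move=> u0; apply/Lspace_eqP; have := @fine_Lnormr_eq0 _ _ _ _ _ _ (Lspace_repr u) u0.
move: Lspace_zeroE; apply: filterS2 => x /(_ I) /= -> /(_ I) /= -> _; exact: erefl.
Qed.

HB.instance Definition _ := Lmodule_isNormed.Build R (LspaceType mu p1)
  normD normZ norm0_eq0.

Lemma Lspace_normE u : `|u| = fine ('N[mu]_p[EFin \o (u : T -> R)])%E.
Proof. by []. Qed.

End Lspace_structure.

Section bochner.
Context d (T : measurableType d) (R : realType).
Variables (mu : {measure set T -> \bar R}) (E : normedModType R).
Implicit Types (s f g : T -> E) (I : E).

Definition simple_function s : Prop :=
  [/\ finite_set (range s),
      forall y, measurable (s @^-1` [set y]) &
      forall y, y != 0 -> (mu (s @^-1` [set y]) < +oo)%E].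

Definition simple_integral s : E :=
  \sum_(y \in range s) fine (mu (s @^-1` [set y])) *: y.

Definition strongly_measurable g : Prop :=
  exists s_ : nat -> T -> E, (forall n, simple_function (s_ n)) /\
    {ae mu, forall t, s_ n t @[n --> \oo] --> g t}.

Definition essentially_bounded g : Prop :=
  exists M : R, {ae mu, forall t, `|g t| <= M}.

(* f is Bochner integrable with integral I. Off a null set `|f - s_ n| agrees
   with a measurable function, and the integral of a nonnegative function is a
   supremum over measurable simple minorants, so null sets do not matter in the
   third clause. *)
Definition is_bochner_integral f I : Prop :=
  exists s_ : nat -> T -> E,
    [/\ forall n, simple_function (s_ n),
        {ae mu, forall t, s_ n t @[n --> \oo] --> f t},
        (\int[mu]_t (`|f t - s_ n t|)%:E)%E @[n --> \oo] --> 0%E &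
        simple_integral (s_ n) @[n --> \oo] --> I].

End bochner.

Section bounded_op_comp.
Context {R : realType} {X Y Z : normedModType R}.

Lemma is_bounded_op_comp (S : bounded_op Y Z) (T : bounded_op X Y) :
  S \o T \in is_bounded_op.
Proof.
apply/is_bounded_opP; split; first by move=> a x y; rewrite /= !linearP.
exists (`|S| * `|T|) => x; rewrite (le_trans (ler_opnorm _ _))//.
by rewrite -mulrA ler_wpM2l// ler_opnorm.
Qed.

Definition bounded_op_comp (S : bounded_op Y Z) (T : bounded_op X Y) :
  bounded_op X Z := BoundedOp (is_bounded_op_comp S T).

End bounded_op_comp.

Definition dual_space {R : realType} (X : normedModType R) := bounded_op X R^o.
HB.instance Definition _ {R : realType} (X : normedModType R) :=
  CompleteNormedModule.on (dual_space X).

(* The coarsest topology making every phi in the dual continuous: it is induced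
   by x |-> (phi x)_phi into the product of copies of R. *)
Definition weak_topology {R : realType} (X : normedModType R) : topologicalType :=
  initial_topology (fun (x : X) => (fun phi => phi x) : {ptws dual_space X -> R^o}).

Definition weakly_compact {R : realType} (X : normedModType R) (A : set X) : Prop :=
  compact (A : set (weak_topology X)).

Definition separable (X : topologicalType) : Prop :=
  exists2 A : set X, countable A & dense A.

Section near_RNP.
Context {R : realType}.

(* Lebesgue measure on [0, 1] as a measure on the real line concentrated on
   [0, 1]: functions are then identified when they agree a.e. on [0, 1], so that
   L1_01 is L^1[0, 1] and representing functions g only matter on [0, 1]. *)
Definition lebesgue01 : {measure set (measurableTypeR R) -> \bar R} :=
  mrestr lebesgue_measure (measurable_itv `[0%R, 1%R]).

Definition L1_01 : normedModType R := LspaceType1 lebesgue01.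

Definition representable (E : normedModType R) (T : bounded_op L1_01 E) : Prop :=
  exists g : R -> E,
    [/\ strongly_measurable lebesgue01 g, essentially_bounded lebesgue01 g &
        forall f : L1_01,
          is_bochner_integral lebesgue01 (fun t => (f t : R) *: g t) (T f)].

Definition dunford_pettis (E : normedModType R) (D : bounded_op L1_01 E) : Prop :=
  forall A : set L1_01, weakly_compact A -> compact (D @` A).

Definition nearly_representable (E : normedModType R) (T : bounded_op L1_01 E) : Prop :=
  forall D : bounded_op L1_01 L1_01, dunford_pettis D ->
    representable (bounded_op_comp T D).

Definition near_RNP (E : completeNormedModType R) : Prop :=
  forall T : bounded_op L1_01 E, nearly_representable T -> representable T.

End near_RNP.

(* Main.v *)
From HB Require Import structures.
Require Import Defs.
From mathcomp Require Import all_boot all_order all_algebra.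
From mathcomp Require Import all_classical all_reals all_analysis.
From mathcomp Require Import measurable_realfun ring lra.
Set Implicit Arguments.
Unset Strict Implicit.
Unset Printing Implicit Defensive.
Import Order.TTheory GRing.Theory Num.Theory.
Import numFieldNormedType.Exports HBSimple HBNNSimple.
Local Open Scope classical_set_scope.
Local Open Scope ring_scope.

(** Let T : L^1[0,1] -> K(X, Y) be nearly representable. Composing T with the
    evaluation at x in X, or with S |-> phi o S for phi in Y^*, yields nearly
    representable operators into Y and X^*, which have densities g_x with values
    in Y and h_phi with values in X^*. A linear combination of densities is
    bounded almost everywhere by the norm of the corresponding combination of
    operators (represents_combination_le). Hence, for x in a countable dense
    subset of X, almost every t makes x |-> g_x(t) compatible with rational
    linear relations and bounded by |T|, so it extends to some G(t) in
    L(X, Y) = K(X, Y) (dense_extension); likewise h_phi(t) = phi o G(t) almost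
    everywhere, for countably many phi at once.

    The heart of the matter is that G is strongly measurable for the operator
    norm, although K(X, Y) may be nonseparable (step_limit_compact_valued). Let
    D be a countable set dense in the values of all the g_x, and for d, d' in D
    let phi be a functional of norm at most 1 with phi (d - d') = |d - d'|
    (norming_functional). As G(t) is compact, there is a finite subset l of D
    such that G(t) maps the unit ball into the e-neighbourhood of l. For the
    finitely many phi attached to pairs in l, the functional h_phi(t) is e-close
    to an element of a countable set, because h_phi is strongly measurable: this
    is where the hypothesis on X^* enters. If G(t) and G(u) share the set l and
    these approximations, then |G(t) - G(u)| <= 6 e, since the distance between
    two points of l can be read off from the functionals phi o G(t) and
    phi o G(u). So countably many measurable pieces, on each of which G
    oscillates by at most 6 e, cover [0,1]; this being true for every e, G is a
    limit of step functions (step_limit_of_covers).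

    Finally G represents T: the distance from T f to the integral of a step
    function s is at most the integral of |f G - s|, as one sees by testing
    against the vectors x of the dense subset, for which g_x is a density
    (representable_of_dist_le). *)

(** * Norming functionals *)

Section norming_functional.
Context {R : realType} {V : normedModType R}.
Implicit Types (p q : V -> R) (x y : V).

Definition sublinear p : Prop :=
  [/\ forall x y, p (x + y) <= p x + p y,
      forall a x, 0 < a -> p (a *: x) <= a * p x &
      forall x, p x <= `|x|].

Lemma sublinearZ p a x : sublinear p -> 0 <= a -> p (a *: x) = a * p x.
Proof.
move=> [_ pZ _]; rewrite le_eqVlt => /predU1P[<-|a0].
  rewrite scale0r mul0r; have := pZ 2 0; have := pZ 2^-1 0; rewrite !scaler0.
  by move=> /(_ ltac:(lra)) h1 /(_ ltac:(lra)) h2; lra.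
apply/eqP; rewrite eq_le pZ//= -ler_pdivlMl//.
by rewrite -{1}(scalerK (lt0r_neq0 a0) x) pZ// invr_gt0.
Qed.

(** The largest sublinear functional below p whose value at - y is at most
    - p y. *)
Definition shave p y x : R := inf [set p (x + t *: y) - t * p y | t in [set t | 0 <= t]].

Lemma shave_le p y x t : sublinear p -> 0 <= t ->
  shave p y x <= p (x + t *: y) - t * p y.
Proof.
move=> sp t0; apply: ge_inf; last by exists t.
exists (- p (- x)) => _ [u /= u0 <-]; have [pD _ _] := sp.
have := pD (x + u *: y) (- x).
by rewrite addrAC subrr add0r (sublinearZ _ sp)//; lra.
Qed.

Lemma shave_ge p y x m :
  (forall t, 0 <= t -> m <= p (x + t *: y) - t * p y) -> m <= shave p y x.
Proof.
move=> h; apply: lb_le_inf => [|_ [t /= t0 <-]]; last exact: h.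
by exists (p (x + 0 *: y) - 0 * p y), 0 => /=.
Qed.

Lemma shave_le_self p y x : sublinear p -> shave p y x <= p x.
Proof.
by move=> sp; have := shave_le y x sp (lexx 0); rewrite scale0r addr0 mul0r subr0.
Qed.

Lemma sublinear_shave p y : sublinear p -> sublinear (shave p y).
Proof.
move=> sp; have [pD pZ pn] := sp; split.
- move=> x1 x2; rewrite -lerBlDr; apply: shave_ge => t t0.
  rewrite lerBlDl -lerBlDr; apply: shave_ge => u u0.
  have := shave_le y (x1 + x2) sp (addr_ge0 t0 u0).
  have := pD (x1 + t *: y) (x2 + u *: y); rewrite addrACA scalerDl; lra.
- move=> a x a0; rewrite -ler_pdivrMl//; apply: shave_ge => t t0.
  rewrite ler_pdivrMl//.
  have := shave_le y (a *: x) sp (mulr_ge0 (ltW a0) t0).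
  by rewrite -scalerA -scalerDr (sublinearZ _ sp (ltW a0)); lra.
- by move=> x; rewrite (le_trans (shave_le_self y x sp)).
Qed.

(** Zorn's lemma applies because the pointwise infimum of a chain of sublinear
    functionals is sublinear; it is finite since p x >= - p (- x) >= - `|x|. *)
Lemma minimal_sublinear p : sublinear p -> exists q,
  [/\ sublinear q, forall x, q x <= p x &
      forall r, sublinear r -> (forall x, r x <= q x) -> r = q].
Proof.
move=> sp; pose S := {q : V -> R | sublinear q /\ forall x, q x <= p x}.
pose le_S (q r : S) := `[< forall x, sval r x <= sval q x >].
have [||||q qmin] := @Zorn S le_S.
- by move=> q; apply/asboolP.
- move=> q r s /asboolP qr /asboolP rs; apply/asboolP => x.
  exact: le_trans (rs x) (qr x).
- move=> [q q'] [r r'] /asboolP/= qr /asboolP/= rq; apply: eq_exist => /=.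
  by apply/funext => x; apply/le_anti; rewrite qr rq.
- move=> A totA; have [[a Aa]|A0] := pselect (exists a, A a); last first.
    by exists (exist _ p (conj sp (fun x => lexx (p x)))) => s As; exfalso; apply: A0; exists s.
  pose m x : R := inf [set sval q x | q in A].
  have mle (q : S) x : A q -> m x <= sval q x.
    move=> Aq; apply: ge_inf; last by exists q.
    exists (- `|x|) => _ [[r [[rD rZ rn] rp]] _ <-] /=.
    have := rD x (- x); have := rn (- x); rewrite normrN subrr.
    have := @sublinearZ r 0 0 (And3 rD rZ rn) (lexx _); rewrite scaler0 mul0r; lra.
  have mge x c : (forall q : S, A q -> c <= sval q x) -> c <= m x.
    move=> h; apply: lb_le_inf; first by exists (sval a x), a.
    by move=> _ [q Aq <-]; exact: h.
  have sm : sublinear m.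
    split.
    + move=> x y; rewrite -lerBlDr; apply: (mge) => q Aq.
      rewrite lerBlDl -lerBlDr; apply: (mge) => r Ar.
      have [/asboolP qr|/asboolP rq] := totA _ _ Aq Ar.
        have := qr x; have := mle _ (x + y) Ar; have [[D _ _] _] := svalP r.
        by have := D x y; lra.
      have := rq y; have := mle _ (x + y) Aq; have [[D _ _] _] := svalP q.
      by have := D x y; lra.
    + move=> b x b0; rewrite -ler_pdivrMl//; apply: (mge) => q Aq.
      rewrite ler_pdivrMl//; have [[_ Z _] _] := svalP q.
      exact: le_trans (mle _ _ Aq) (Z _ _ b0).
    + move=> x; have [[_ _ n] _] := svalP a; exact: le_trans (mle _ _ Aa) (n x).
  have mp x : m x <= p x by have [_ n] := svalP a; exact: le_trans (mle _ _ Aa) (n x).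
  by exists (exist _ m (conj sm mp)) => s As; apply/asboolP => x; exact: mle.
- have [sq qp] := svalP q; exists (sval q); split=> // r sr rq.
  have rp x : r x <= p x by exact: le_trans (rq x) (qp x).
  by rewrite -(qmin (exist _ r (conj sr rp)))//; apply/asboolP.
Qed.

(** A consequence of the Hahn-Banach theorem, proved without extending
    functionals from subspaces: a minimal sublinear functional q is linear, as
    shave q y lies below q, hence equals q, and then q x <= q (x + y) - q y.
    Minimising below shave `|.| y forces q (- y) <= - `|y|. *)
Lemma norming_functional y :
  exists phi : dual_space V, (forall x, `|phi x| <= `|x|) /\ phi y = `|y|.
Proof.
have sn : sublinear (fun x : V => `|x|).
  by split=> [x z|a x a0|x]; rewrite ?ler_normD// normrZ gtr0_norm.
have [q [sq qp qmin]] := minimal_sublinear (sublinear_shave y sn).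
have qD x z : q (x + z) = q x + q z.
  have [D _ _] := sq; apply/le_anti; rewrite D/=.
  have qE : shave q z = q.
    by apply: qmin => [|w]; [exact: sublinear_shave|exact: shave_le_self].
  have := shave_le z x sq ler01; rewrite qE scale1r mul1r; lra.
have qN x : q (- x) = - q x.
  have := qD x (- x); rewrite subrr.
  have := sublinearZ 0 sq (lexx 0); rewrite scaler0 mul0r; lra.
have qZ a x : q (a *: x) = a * q x.
  have [a0|a0] := leP 0 a; first exact: sublinearZ.
  rewrite -[a]opprK scaleNr qN sublinearZ//; [ring|lra].
have qle x : `|q x| <= `|x|.
  have [_ _ n] := sq; rewrite ler_norml n andbT.
  by have := n (- x); rewrite qN normrN; lra.
have qP : (q : V -> R^o) \in is_bounded_op.
  apply/is_bounded_opP; split=> [a x z|]; first by rewrite qD qZ.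
  by exists 1 => x; rewrite mul1r.
exists (BoundedOp qP); split=> //=.
apply/le_anti; rewrite (le_trans (ler_norm _) (qle y))/=.
have := qp (- y); have := shave_le y (- y) sn ler01.
by rewrite scale1r addNr normr0 mul1r qN; lra.
Qed.

End norming_functional.

(** * Extension of operators from a dense sequence *)

Section extension_from_dense.
Context {R : realType} {X : normedModType R} {Y : completeNormedModType R}.

Lemma ge0_on_rat (f : R -> R) : continuous f ->
  (forall q : rat, 0 <= f (ratr q)) -> forall a, 0 <= f a.
Proof.
move=> cf fq a; rewrite leNgt; apply/negP => fa.
have [||r [/= fq0 [q _ qE]]] := @dense_rat R (f @^-1` [set y | y < 0]).
- by exists a.
- by apply: open_comp => [x _|]; [exact: cf|exact: open_lt].
- by move: fq0; rewrite -qE ltNge fq.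
Qed.

Lemma le_epsilon_mul (x K : R) : 0 <= K -> (forall e, 0 < e -> x <= K * e) -> x <= 0.
Proof.
move=> K0 h; apply/ler_addgt0Pr => e e0; rewrite add0r.
have K1 : 0 < K + 1 by lra.
apply: (le_trans (h _ (divr_gt0 e0 K1))).
by rewrite mulrCA ger_pMr// ler_pdivrMr// mul1r; lra.
Qed.

Lemma ler_dist_addr (V : normedModType R) (w v z w' v' z' : V) :
  `|w - (v + z)| <= `|w - w'| + `|v - v'| + `|z - z'| + `|w' - (v' + z')|.
Proof.
have := ler_distD w' w (v + z); have := ler_distD (v' + z') w' (v + z).
have : `|v' + z' - (v + z)| <= `|v - v'| + `|z - z'|.
  by rewrite opprD addrACA (distrC v) (distrC z) ler_normD.
lra.
Qed.

(** Besides linearity, the single inequality carries the two bounds which the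
    extension rests on: with q = 0 it makes u Lipschitz along xs, and with
    i = j = k and q = 1 it bounds u i by C |xs i|. It passes from rational to real
    q by continuity. *)
Lemma dense_extension (xs : nat -> X) (u : nat -> Y) (C : R) : 0 <= C ->
  (forall x (e : R), 0 < e -> exists n, `|x - xs n| < e) ->
  (forall (q : rat) i j k,
    `|u k - (ratr q *: u i + u j)| <= C * `|xs k - (ratr q *: xs i + xs j)|) ->
  exists2 S : bounded_op X Y, forall n, S (xs n) = u n & forall x, `|S x| <= C * `|x|.
Proof.
move=> C0 dxs uq.
have ur a i j k : `|u k - (a *: u i + u j)| <= C * `|xs k - (a *: xs i + xs j)|.
  rewrite -subr_ge0.
  apply: (@ge0_on_rat (fun a => C * `|xs k - (a *: xs i + xs j)| - `|u k - (a *: u i + u j)|)).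
    have cl (Z : normedModType R) (w v z : Z) :
        continuous (fun b : R => `|w - (b *: v + z)|).
      move=> b; apply: cvg_norm; apply: cvgB; first exact: cvg_cst.
      by apply: cvgD; [apply: cvgZ; [exact: cvg_id|exact: cvg_cst]|exact: cvg_cst].
    by move=> b; apply: cvgB; [apply: cvgM; [exact: cvg_cst|]|]; exact: cl.
  by move=> q; rewrite subr_ge0.
have uB i j : `|u i - u j| <= C * `|xs i - xs j|.
  by have := ur 0 i j i; rewrite !scale0r !add0r.
have Sex x : exists y : Y, forall n, `|y - u n| <= C * `|x - xs n|.
  have /choice[nx nxP] m : exists n, `|x - xs n| < m.+1%:R^-1 by exact: dxs.
  have near_inv (e : R) : 0 < e -> \forall m \near \oo, m.+1%:R^-1 < e.
    by move=> e0; exact: near_infty_natSinv_lt (PosNum e0).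
  have : cvg ((fun m => u (nx m)) @ \oo).
    apply: cauchy_cvg; apply/cauchyP => e e0.
    have d0 : 0 < e / (2 * C + 1) by rewrite divr_gt0//; lra.
    have [N _ NP] := near_inv _ d0.
    exists (u (nx N)); exists N => // m /= Nm; rewrite -ball_normE /=.
    rewrite (le_lt_trans (uB _ _))//.
    have := NP N (leqnn _); have := NP m Nm; rewrite /= => hm hN.
    have : `|xs (nx N) - xs (nx m)| <= 2 * (e / (2 * C + 1)).
      rewrite -(subrKA x) (le_trans (ler_normD _ _))//.
      rewrite (distrC (xs (nx N))) mulrDl mul1r.
      by rewrite lerD// ltW// (lt_trans (nxP _)).
    move=> /(ler_wpM2l C0)/le_lt_trans; apply.
    have : (2 * C + 1) * (e / (2 * C + 1)) = e by rewrite mulrC divfK// gt_eqF//; lra.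
    lra.
  move=> /cvg_ex[y yP]; exists y => n.
  have cn : (fun m => `|u (nx m) - u n|) @ \oo --> `|y - u n|.
    by apply: cvg_norm; apply: cvgB => //; exact: cvg_cst.
  rewrite -subr_le0.
  apply: (@le_epsilon_mul _ C) => // e e0.
  rewrite lerBlDl -mulrDr.
  apply: (closed_cvg (fun r => r <= C * (`|x - xs n| + e)) _ _ _ cn).
    exact: closed_le.
  apply: filterS (near_inv _ e0) => m me; rewrite (le_trans (uB _ _))//.
  rewrite ler_wpM2l// (le_trans (ler_distD x _ _))// [leRHS]addrC lerD2r.
  by rewrite distrC ltW// (lt_trans (nxP m)).
have {Sex}/choice[S SP] := Sex.
have Slin : linear S.
  move=> a x y; apply/eqP; rewrite -subr_eq0 -normr_le0.
  apply: (@le_epsilon_mul _ (C * 2 * (2 + `|a|))) => [|e e0].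
    by rewrite !mulr_ge0// addr_ge0.
  have [i xi] := dxs x e e0; have [j yj] := dxs y e e0.
  have [k zk] := dxs (a *: x + y) e e0.
  have a0 := normr_ge0 a.
  have axi : `|a *: (x - xs i)| <= `|a| * e by rewrite normrZ ler_wpM2l// ltW.
  have hx := ler_dist_addr (xs k) (a *: xs i) (xs j) (a *: x + y) (a *: x) y.
  have hu := ler_dist_addr (S (a *: x + y)) (a *: S x) (S y) (u k) (a *: u i) (u j).
  move: hx hu; rewrite subrr normr0 addr0 -!scalerBr !normrZ => hx hu.
  have hS := SP (a *: x + y) k; have := SP x i; have := SP y j => hy hx'.
  move: axi hx; rewrite normrZ (distrC (xs k) (a *: x + y)) (distrC (xs i)) (distrC (xs j)) => axi hx.
  have h1 := ler_wpM2l a0 hx'.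
  have h2 := ur a i j k.
  have h3 : C * `|xs k - (a *: xs i + xs j)| <= C * ((2 + `|a|) * e).
    by rewrite ler_wpM2l//; lra.
  have h4 : C * `|a *: x + y - xs k| <= C * e by rewrite ler_wpM2l// ltW.
  have h5 : C * `|y - xs j| <= C * e by rewrite ler_wpM2l// ltW.
  have h6 : `|a| * (C * `|x - xs i|) <= C * (`|a| * e) by rewrite mulrCA ler_wpM2l.
  lra.
have Sb x : `|S x| <= C * `|x|.
  rewrite -subr_le0; apply: (@le_epsilon_mul _ (2 * C)) => [|e e0]; first lra.
  have [i xi] := dxs x e e0; have hS := SP x i.
  have ui : `|u i| <= C * `|xs i|.
    have := ur 1 i i i; rewrite !scale1r.
    by rewrite -(distrC (u i + u i)) -(distrC (xs i + xs i)) !addrK.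
  have h1 : C * `|x - xs i| <= C * e by rewrite ler_wpM2l// ltW.
  have h2 : C * `|xs i| <= C * (`|x| + e).
    by rewrite ler_wpM2l//; have := ler_distD x (xs i) 0; rewrite !subr0 distrC; lra.
  by have := ler_distD (u i) (S x) 0; rewrite !subr0; lra.
have SB : S \in is_bounded_op by apply/is_bounded_opP; split=> //; exists C.
exists (BoundedOp SB) => // n /=; apply/eqP; rewrite -subr_eq0 -normr_le0.
by rewrite (le_trans (SP _ n))// subrr normr0 mulr0.
Qed.

End extension_from_dense.

(** * Step functions and their pointwise limits *)

Section step_functions.
Context d (T : measurableType d).

(** The codomain is arbitrary, so that pairs and membership tests of step
    functions are again step functions. *)
Definition step {E : Type} (s : T -> E) : Prop :=
  finite_set (range s) /\ forall y, measurable (s @^-1` [set y]).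

Lemma step_preimage {E : choiceType} (s : T -> E) (A : set E) :
  step s -> measurable (s @^-1` A).
Proof.
move=> [fs ms].
have -> : s @^-1` A = \bigcup_(y in range s `&` A) s @^-1` [set y].
  apply/seteqP; split=> [t At|t [y [_ Ay] /= ->]//].
  by exists (s t) => //; split=> //; exists t.
by apply: fin_bigcup_measurable => //; exact: finite_setIl.
Qed.

Lemma step_comp {E : choiceType} {F : Type} (f : E -> F) (s : T -> E) :
  step s -> step (f \o s).
Proof.
move=> ss; split=> [|y]; last by rewrite comp_preimage; exact: step_preimage.
by rewrite -(image_comp s f); apply: finite_image; case: ss.
Qed.

Lemma step_pair {E F : choiceType} (s : T -> E) (r : T -> F) :
  step s -> step r -> step (fun t => (s t, r t)).
Proof.
move=> [fs ms] [fr mr]; split.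
  apply: sub_finite_set (finite_setX fs fr) => _ [t _ <-].
  by split; exists t.
move=> [x y]; have -> : (fun t => (s t, r t)) @^-1` [set (x, y)] =
    s @^-1` [set x] `&` r @^-1` [set y].
  by apply/seteqP; split=> [t [/= -> ->]|t [/= -> ->]].
exact: measurableI.
Qed.

Lemma step_cst {E : Type} (c : E) : step (cst c : T -> E).
Proof.
split=> [|y]; last by rewrite preimage_cst; case: ifP.
by apply: sub_finite_set (finite_set1 c) => _ [t _ <-].
Qed.

Lemma step_mem (A : set T) : measurable A -> step (fun t => t \in A).
Proof.
move=> mA; split; first exact: finite_finset.
case.
  have -> : (fun t => t \in A) @^-1` [set true] = A => //.
  by apply/seteqP; split=> t /=; [move/set_mem|move/mem_set].
have -> : (fun t => t \in A) @^-1` [set false] = ~` A; last exact: measurableC.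
apply/seteqP; split=> t /=; last exact: memNset.
by move=> tA /mem_set; rewrite tA.
Qed.

End step_functions.

Section pointwise_limits.
Context d (T : measurableType d) (R : realType).

(** Unlike strong measurability, this asks for convergence everywhere; it is
    thus stable under composition with continuous maps and yields
    measurability on the nose rather than up to null sets. *)
Definition step_limit {E : normedModType R} (g : T -> E) : Prop :=
  exists2 s_ : nat -> T -> E, forall n, step (s_ n) &
    forall t, s_ n t @[n --> \oo] --> g t.

Lemma step_step_limit {E : normedModType R} (s : T -> E) : step s -> step_limit s.
Proof. by move=> ss; exists (fun=> s) => // t; exact: cvg_cst. Qed.

Lemma step_limit_comp2 {E F G : normedModType R} (phi : E * F -> G) g h :
  continuous phi -> step_limit g -> step_limit h ->
  step_limit (fun t => phi (g t, h t)).
Proof.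
move=> cphi [s_ ss sg] [r_ sr rh]; exists (fun n t => phi (s_ n t, r_ n t)).
  by move=> n; apply: (@step_comp _ _ _ _ phi); exact: step_pair.
move=> t; apply: continuous_cvg; first exact: cphi.
by apply: cvg_pair; [exact: sg|exact: rh].
Qed.

Lemma step_limit_comp {E F : normedModType R} (phi : E -> F) g :
  continuous phi -> step_limit g -> step_limit (phi \o g).
Proof.
move=> cphi [s_ ss sg]; exists (fun n => phi \o s_ n).
  by move=> n; exact: step_comp.
by move=> t; apply: continuous_cvg; [exact: cphi|exact: sg].
Qed.

Lemma measurable_step_limit (g : T -> R^o) :
  step_limit g -> measurable_fun setT (g : T -> R).
Proof.
move=> [s_ ss sg]; apply: (@measurable_fun_cvg _ _ _ _ (s_ : nat -> T -> R)).
  by move=> n _ A mA; rewrite setTI; exact: step_preimage.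
by move=> t _; exact: sg.
Qed.

Lemma measurable_step_limit_dist {E : normedModType R} (g h : T -> E) :
  step_limit g -> step_limit h -> measurable_fun setT (fun t => `|g t - h t|).
Proof.
move=> sg sh; apply: (@measurable_step_limit (fun t => `|g t - h t|)).
apply: (@step_limit_comp2 _ _ _ (fun z => `|z.1 - z.2| : R^o)) sg sh => z.
by apply: cvg_norm; apply: cvgB; [exact: cvg_fst|exact: cvg_snd].
Qed.

Lemma measurable_fun_step_limit (f : T -> R) :
  measurable_fun setT f -> step_limit (f : T -> R^o).
Proof.
move=> mf; have /measurable_EFinP mf' := mf.
have [g gf] := approximation_sfun measurableT mf'.
exists (fun n t => (g n t : R)).
  move=> n; split; first exact: fimfunP.
  by move=> y; apply: (@measurable_funPTI _ _ _ _ (g n)); exact: measurable_set1.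
by move=> t; have /fine_cvgP[] := gf t I.
Qed.

Lemma step_limitZ {E : normedModType R} (f : T -> R) (g : T -> E) :
  measurable_fun setT f -> step_limit g -> step_limit (fun t => f t *: g t).
Proof.
move=> /measurable_fun_step_limit sf sg.
apply: (@step_limit_comp2 _ _ _ (fun z : R^o * E => (z.1 : R) *: z.2)) sf sg => z.
by apply: cvgZ; [exact: cvg_fst|exact: cvg_snd].
Qed.

(** The values of the approximating step functions form a countable set. *)
Lemma step_limit_dense {E : normedModType R} (g : T -> E) : step_limit g ->
  exists c : nat -> E, forall t (e : R), 0 < e -> exists n, `|g t - c n| < e.
Proof.
move=> [s_ ss sg].
have /choice[l lP] n : exists l : seq E, range (s_ n) = [set` l].
  by have [fs _] := ss n; exact/finite_seqP.
exists (fun k => if (unpickle k : option (nat * nat)) is Some (n, i) then nth 0 (l n) i else 0) => t e e0.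
have /cvgrPdist_lt/(_ e e0)[N _ /(_ N (leqnn N)) sN] := sg t.
have : [set` l N] (s_ N t) by rewrite -lP; exists t.
move=> /(nthP 0)[i il iE]; exists (pickle (N, i)).
by rewrite pickleK iE.
Qed.

(** Choosing one value of g on each piece of each cover gives countably many
    values. At time k the approximant at t takes the value chosen on the finest
    piece containing t among those with code below k. *)
Lemma step_limit_of_covers {E : normedModType R} (g : T -> E) :
  (forall e : R, 0 < e -> exists A : nat -> set T,
    [/\ forall i, measurable (A i), forall t, exists i, A i t &
        forall i t u, A i t -> A i u -> `|g t - g u| <= e]) ->
  step_limit g.
Proof.
move=> cov.
have /choice[A AP] m := cov m.+1%:R^-1 ltac:(by rewrite invr_gt0).
have /choice[c cP] (z : nat * nat) : exists c : E, forall t, A z.1 z.2 t ->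
    `|g t - c| <= z.1.+1%:R^-1.
  have [[u Au]|Au] := pselect (exists u, A z.1 z.2 u); last first.
    by exists 0 => t At; exfalso; apply: Au; exists t.
  by exists (g u) => t At; have [_ _ /(_ z.2 t u)] := AP z.1; apply.
(* A state (m.+1, v) records a value v known to be 1 / (m + 1)-close to g t; at
   level 0 nothing is known. *)
pose upd (b : bool) (z : nat * nat) (w : nat * E) :=
  if b && (w.1 <= z.1.+1)%N then (z.1.+1, c z) else w.
pose fix w (k : nat) (t : T) {struct k} : nat * E := if k is k'.+1 then
    if (unpickle k' : option (nat * nat)) is Some z then upd (t \in A z.1 z.2) z (w k' t) else w k' t
  else (0%N, 0).
have sw k : step (w k).
  elim: k => [|k IH] /=; first exact: step_cst.
  case: unpickle => [z|//].
  apply: (@step_comp _ _ _ _ (fun p : bool * (nat * E) => upd p.1 z p.2)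
    (fun t => (t \in A z.1 z.2, w k t))).
  by apply: step_pair => //; apply: step_mem; have [] := AP z.1.
have wg k t m : (w k t).1 = m.+1 -> `|g t - (w k t).2| <= m.+1%:R^-1.
  elim: k m => [|k IH] m //=; case: unpickle => [z|]; last exact: IH.
  rewrite /upd; case: ifPn => [/andP[/set_mem At _] /= [<-]|_]; last exact: IH.
  exact: cP.
have wS k t : ((w k t).1 <= (w k.+1 t).1)%N.
  rewrite /=; case: unpickle => [z|//]; rewrite /upd.
  by case: ifPn => // /andP[].
have wle j k t : (j <= k)%N -> ((w j t).1 <= (w k t).1)%N.
  move=> jk; have := @homo_leq _ (fun i => (w i t).1) leq.
  by move=> /(_ leqnn (@leq_trans) (fun i => wS i t)); apply.
exists (fun k t => (w k t).2) => [n|t]; first exact: (@step_comp _ _ _ _ snd).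
apply/cvgrPdist_le => e e0.
have [N _ NP] := near_infty_natSinv_lt (PosNum e0).
have [_ /(_ t)[i Ati] _] := AP N.
exists (pickle (N, i)).+1 => // k /= Nk.
have : (N.+1 <= (w k t).1)%N.
  apply: leq_trans (wle _ _ t Nk) => /=; rewrite pickleK /upd.
  rewrite (mem_set Ati) /=; case: ifPn => //=; rewrite -ltnNge; exact: ltnW.
case wE : (w k t).1 => [//|m] Nm; rewrite (le_trans (wg _ _ _ wE))// ltW//.
exact: (NP m).
Qed.

Lemma strongly_measurable_step_limit (mu : {measure set T -> \bar R})
  {E : normedModType R} (g : T -> E) : strongly_measurable mu g ->
  exists2 h, step_limit h & {ae mu, forall t, g t = h t}.
Proof.
move=> [s_ [ss [N [mN N0 sN]]]].
exists (fun t => if t \in N then 0 else g t); last first.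
  exists N; split=> // t /= gt; apply: contrapT => Nt; apply: gt.
  by rewrite memNset.
exists (fun n t => if t \in N then 0 else s_ n t) => [n|t].
  apply: (@step_comp _ _ _ _ (fun p : bool * E => if p.1 then 0 else p.2)
    (fun t => (t \in N, s_ n t))).
  by apply: step_pair; [exact: step_mem|split; have [] := ss n].
case: ifPn => [_|/negP Nt]; first exact: cvg_cst.
by apply: contrapT => h; apply: Nt; apply/mem_set; exact: sN.
Qed.

End pointwise_limits.

(** * Integrals of simple functions *)

Section lower_integral.
Local Open Scope ereal_scope.
Context d (T : measurableType d) (R : realType).
Variable mu : {measure set T -> \bar R}.

Lemma sintegral_le_integral (h : {nnsfun T >-> R}) (g : T -> \bar R) :
  (forall t, 0 <= g t) -> (forall t, (h t)%:E <= g t) ->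
  sintegral mu h <= \int[mu]_t g t.
Proof.
by move=> g0 hg; rewrite ge0_integralTE//; apply: ereal_sup_ubound; exists h.
Qed.

(** Without measurability the integral of a nonnegative function is the
    supremum of the integrals of its simple minorants, which still gives
    monotonicity; null sets are absorbed by cutting the minorants. *)
Lemma ae_le_lower_integral (K : R) (f g : T -> \bar R) : (0 < K)%R ->
  (forall t, 0 <= f t) -> (forall t, 0 <= g t) ->
  {ae mu, forall t, f t <= K%:E * g t} ->
  \int[mu]_t f t <= K%:E * \int[mu]_t g t.
Proof.
move=> K0 f0 g0 [N [mN N0 fgN]].
rewrite ge0_integralTE//; apply: ub_ereal_sup => _ [h hf <-].
have Kv0 : (0 <= K^-1)%R by rewrite invr_ge0 ltW.
pose h' := scale_nnsfun (proj_nnsfun h (measurableC mN)) Kv0.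
have h'E t : h' t = (K^-1 * (h t * (\1_(~` N) t)))%R by [].
have -> : sintegral mu h = K%:E * sintegral mu h'.
  have -> : sintegral mu h = \int[mu]_t (h t)%:E by rewrite integral_nnsfun// patch_setT.
  have -> : sintegral mu h' = \int[mu]_t (h' t)%:E by rewrite integral_nnsfun// patch_setT.
  rewrite -ge0_integralZl//; last 3 first.
  - exact/measurable_EFinP.
  - by move=> t _; rewrite lee_fin.
  - by rewrite lee_fin ltW.
  apply: ge0_ae_eq_integral => //.
  - exact/measurable_EFinP.
  - by apply: measurable_funeM; exact/measurable_EFinP.
  - by move=> t _; rewrite lee_fin.
  - by move=> t _; rewrite mule_ge0// lee_fin// ltW.
  exists N; split=> // t /=; apply: contra_notP => Nt _.
  rewrite -[mindic _ _ t]/((\1_(~` N) t)%R : R) -EFinM mulVKf ?gt_eqF//.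
  by rewrite indicE mem_set// mulr1.
rewrite lee_pmul2l ?lte_fin//; apply: sintegral_le_integral => // t.
rewrite h'E indicE; have [tN|tN] := boolP (t \in ~` N); last first.
  by rewrite !mulr0.
rewrite mulr1 EFinM lee_pdivrMl//.
apply: (le_trans (hf t)); apply: contrapT => h1; move/set_mem: tN; apply.
exact: fgN.
Qed.

End lower_integral.

Section simple_integrals.
Context d (T : measurableType d) (R : realType).
Variable mu : {measure set T -> \bar R}.
Hypothesis mu_fin : (mu setT < +oo)%E.

Lemma finite_measure_lty (A : set T) : measurable A -> (mu A < +oo)%E.
Proof. by move=> mA; rewrite (le_lt_trans _ mu_fin)// le_measure ?inE. Qed.

Lemma finite_measure_fin_num (A : set T) : measurable A -> mu A \is a fin_num.
Proof. by move=> mA; rewrite ge0_fin_numE// finite_measure_lty. Qed.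

Lemma step_simple_function {E : normedModType R} (s : T -> E) :
  step s -> simple_function mu s.
Proof. by move=> [fs ms]; split=> // y _; exact: finite_measure_lty. Qed.

Lemma simple_function_step {E : normedModType R} (s : T -> E) :
  simple_function mu s -> step s.
Proof. by case. Qed.

(** The integral of a step function may be computed on any refinement of its
    fibres; refining by a pair of step functions makes their integrals
    comparable. *)
Lemma simple_integral_comp {I : choiceType} {E : normedModType R} (f : I -> E)
  (r : T -> I) : step r ->
  simple_integral mu (f \o r) = \sum_(i \in range r) fine (mu (r @^-1` [set i])) *: f i.
Proof.
move=> sr; have [fr mr] := sr.
rewrite /simple_integral -(image_comp r f) !fsbig_finite//; last exact: finite_image.
rewrite fset_set_image//= [RHS](finmap.partition_big_imfset _ f).
apply: eq_bigr => y _; rewrite (eq_bigr (fun i => fine (mu (r @^-1` [set i])) *: y)).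
  rewrite -scaler_suml; congr (_ *: _).
  rewrite sum_fine => [|i _]; last exact: finite_measure_fin_num.
  congr (fine _).
  have -> : (f \o r) @^-1` [set y] = \bigcup_(i in range r `&` f @^-1` [set y]) r @^-1` [set i].
    apply/seteqP; split=> [t fy|t [_ [[u _ <-] fy] /= ->]//].
    by exists (r t) => //; split=> //; exists t.
  rewrite measure_fin_bigcup//; last 2 first.
  - exact: finite_setIl.
  - by move=> i j _ _ [t [/= <- <-]].
  rewrite fsbig_mkcondr fsbig_finite// [in RHS]big_mkcond/=.
  apply: eq_bigr => i _; congr (if _ then _ else _).
  by apply/idP/eqP => [/set_mem//|fi]; exact/mem_set.
by move=> i /eqP ->.
Qed.

Lemma simple_integral_linear {E F : normedModType R} (L : bounded_op E F)
  (s : T -> E) : step s -> simple_integral mu (L \o s) = L (simple_integral mu s).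
Proof.
move=> ss; have [fs _] := ss; rewrite simple_integral_comp// /simple_integral !fsbig_finite//.
by rewrite linear_sum; apply: eq_bigr => i _; rewrite linearZ.
Qed.

Lemma simple_integral_indic {E : normedModType R} (A : set T) (c : E) :
  measurable A ->
  simple_integral mu (fun t => if t \in A then c else 0) = fine (mu A) *: c.
Proof.
move=> mA.
rewrite (@simple_integral_comp _ _ (fun b : bool => if b then c else 0) (fun t => t \in A));
  last exact: step_mem.
rewrite (fsbig_widen _ setT)//=; last first.
  by move=> b [_ /= nb]; rewrite preimage10 ?measure0 ?scale0r.
rewrite -(fsbig_widen [set true] setT)//=; last by move=> [] [_ /= nb]; rewrite ?scaler0.
rewrite fsbig_set1; congr (fine (mu _) *: _).
by apply/seteqP; split=> t /=; [move/set_mem|move/mem_set].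
Qed.

Lemma simple_integral_ge0 (s : T -> R^o) : step s -> (forall t, 0 <= (s t : R)) ->
  (simple_integral mu s : R)%:E = (\int[mu]_t (s t : R)%:E)%E.
Proof.
move=> ss s0; have [fs ms] := ss.
have mfs : measurable_fun setT (s : T -> R).
  by move=> _ A mA; rewrite setTI; exact: step_preimage.
pose h : {nnsfun T >-> R} := HB.pack (s : T -> R)
  (@isNonNegFun.Build _ _ (s : T -> R) s0) (isMeasurableFun.Build _ _ _ _ _ mfs)
  (@FiniteImage.Build _ _ (s : T -> R) fs).
rewrite -[RHS]/(\int[mu]_t (h t)%:E)%E integral_nnsfun// patch_setT sintegralE.
rewrite /simple_integral !fsbig_finite//= -sumEFin; apply: eq_bigr => y _.
rewrite EFinM fineK; last exact: finite_measure_fin_num.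
by rewrite muleC.
Qed.

Lemma simple_integral_dist_le {E : normedModType R} (s r : T -> E) :
  step s -> step r ->
  (`|simple_integral mu s - simple_integral mu r|%:E <=
   \int[mu]_t `|s t - r t|%:E)%E.
Proof.
move=> ss sr; pose p t := (s t, r t); have sp : step p by exact: step_pair.
have sd : step (fun t => `|s t - r t| : R^o).
  exact: (@step_comp _ _ _ _ (fun z => `|z.1 - z.2| : R^o) p).
rewrite -(simple_integral_ge0 sd)//.
rewrite (@simple_integral_comp _ _ (fun z => `|z.1 - z.2| : R^o) p)//.
rewrite (@simple_integral_comp _ _ fst p)// (@simple_integral_comp _ _ snd p)//.
have [fp _] := sp; rewrite !fsbig_finite//= -sumrB lee_fin.
rewrite (le_trans (ler_norm_sum _ _ _))//; apply: ler_sum => z _.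
by rewrite -scalerBr normrZ ger0_norm// fine_ge0.
Qed.

End simple_integrals.

(** * Bochner integrals *)

Section bochner_integrals.
Context d (T : measurableType d) (R : realType).
Variable mu : {measure set T -> \bar R}.
Hypothesis mu_fin : (mu setT < +oo)%E.

Lemma eventually_lt_of_cvg0 (u : nat -> \bar R) : u @ \oo --> 0%E ->
  forall e : R, 0 < e -> \forall n \near \oo, (u n < e%:E)%E.
Proof.
move=> u0 e e0; have /fine_cvgP[fu /cvgrPdist_lt/(_ e e0) eu] := u0.
apply: filterS2 fu eu => n fun_; rewrite sub0r normrN => un.
by rewrite -(fineK fun_) lte_fin (le_lt_trans (ler_norm _)).
Qed.

(** All estimates on Bochner integrals below are comparisons with the integral
    of a step function. The function |f - s_n| need not be measurable, but
    almost everywhere it is at least the measurable function |s_n - s| - psi,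
    whose positive part thus has an integral tending to 0. *)
Lemma bochner_integral_dist_le {E : normedModType R} (f : T -> E) I (s : T -> E)
  (psi : T -> R) : is_bochner_integral mu f I -> step s ->
  measurable_fun setT psi -> (forall t, 0 <= psi t) ->
  {ae mu, forall t, `|f t - s t| <= psi t} ->
  (`|I - simple_integral mu s|%:E <= \int[mu]_t (psi t)%:E)%E.
Proof.
move=> [s_ [ss _ sf sI]] st mpsi psi0 fs.
have [->|pfin] := eqVneq (\int[mu]_t (psi t)%:E)%E +oo%E; first exact: leey.
have pfn : (\int[mu]_t (psi t)%:E)%E \is a fin_num.
  by rewrite ge0_fin_numE ?ltey// integral_ge0// => t _; rewrite lee_fin.
rewrite -(fineK pfn) lee_fin; apply/ler_addgt0Pr => e e0.
have e20 : 0 < e / 2 by rewrite divr_gt0.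
have := eventually_lt_of_cvg0 sf e20.
move/cvgrPdist_lt : sI => /(_ _ e20) sI sfe.
have [n [In fn]] := filter_ex (filterI sI sfe).
have stn : step (s_ n) by exact: simple_function_step (ss n).
rewrite (le_trans (ler_distD (simple_integral mu (s_ n)) _ _))//.
have -> : fine (\int[mu]_t (psi t)%:E)%E + e =
    e / 2 + (fine (\int[mu]_t (psi t)%:E)%E + e / 2) by rewrite addrCA -splitr.
apply: lerD; first exact: ltW.
rewrite -lee_fin (le_trans (simple_integral_dist_le mu_fin stn st))//.
pose k t := Num.max 0 (`|s_ n t - s t| - psi t).
have msn : measurable_fun setT (fun t => `|s_ n t - s t|).
  by apply: measurable_step_limit_dist; exact: step_step_limit.
have mk : measurable_fun setT k.
  by apply: measurable_maxr; [exact: measurable_cst|exact: measurable_funB].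
have k0 t : 0 <= k t by rewrite /k le_max lexx.
rewrite (@le_trans _ _ (\int[mu]_t (k t)%:E + \int[mu]_t (psi t)%:E)%E)//.
  rewrite -ge0_integralD//; last 4 first.
  - by move=> t _; rewrite lee_fin.
  - exact/measurable_EFinP.
  - by move=> t _; rewrite lee_fin.
  - exact/measurable_EFinP.
  apply: ge0_le_integral => //.
  - exact/measurable_EFinP.
  - by apply: emeasurable_funD; exact/measurable_EFinP.
  - move=> t _; rewrite -EFinD lee_fin /k -lerBlDr.
    by rewrite le_max lexx orbT.
rewrite EFinD fineK// addeC leeD2l//.
have h : {ae mu, forall t, ((k t)%:E <= 1%:E * (`|f t - s_ n t|)%:E)%E}.
  apply: filterS fs => t ft; rewrite mul1e lee_fin /k ge_max normr_ge0/=.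
  rewrite lerBlDr (le_trans (ler_distD (f t) _ _))// distrC lerD2l//.
by rewrite (le_trans (ae_le_lower_integral ltr01 _ _ h))// mul1e ltW.
Qed.

Lemma bochner_integral_ae_eq {E : normedModType R} (f g : T -> E) I :
  {ae mu, forall t, f t = g t} -> is_bochner_integral mu f I ->
  is_bochner_integral mu g I.
Proof.
move=> fg [s_ [ss sf s0 sI]]; exists s_; split=> //.
  by apply: filterS2 fg sf => t ->.
apply: (squeeze_cvge _ (cvg_cst 0%E) s0); apply: nearW => n.
apply/andP; split; first by apply: integral_ge0 => t _; rewrite lee_fin.
rewrite -[leRHS]mul1e; apply: ae_le_lower_integral => //.
by apply: filterS fg => t ->; rewrite mul1e.
Qed.

Lemma bochner_integral_linear {E F : normedModType R} (L : bounded_op E F)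
  (f : T -> E) I : is_bochner_integral mu f I ->
  is_bochner_integral mu (L \o f) (L I).
Proof.
move=> [s_ [ss sf s0 sI]]; exists (fun n => L \o s_ n).
have cL : continuous L by exact: bounded_op_continuous.
have K0 : 0 < `|L| + 1 by rewrite ltr_wpDl.
split=> [n||| ].
- apply: step_simple_function => //; apply: step_comp.
  exact: simple_function_step (ss n).
- by apply: filterS sf => t; apply: continuous_cvg; exact: cL.
- have s0' : ((`|L| + 1)%:E * \int[mu]_t (`|f t - s_ n t|)%:E)%E @[n --> \oo] --> 0%E.
    by rewrite -(mule0 (`|L| + 1)%:E); exact: cvgeZl.
  apply: (squeeze_cvge _ (cvg_cst 0%E) s0'); apply: nearW => n.
  apply/andP; split; first by apply: integral_ge0 => t _; rewrite lee_fin.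
  apply: ae_le_lower_integral => //; apply: aeW => t.
  rewrite -EFinM lee_fin -linearB (le_trans (ler_opnorm _ _))// ler_wpM2r//.
  by rewrite lerDl.
- under eq_fun do rewrite (simple_integral_linear mu_fin L (simple_function_step (ss _))).
  by apply: continuous_cvg; [exact: cL|].
Qed.

(** Cutting off the approximants of f where they exceed 2 b preserves pointwise
    convergence, as b is positive wherever f does not vanish, and makes 3 b
    dominate the error. *)
Lemma step_limit_L1_approx {E : normedModType R} (f : T -> E) (b : T -> R) :
  step_limit f -> measurable_fun setT b -> (forall t, `|f t| <= b t) ->
  mu.-integrable setT (EFin \o b) ->
  exists s_ : nat -> T -> E, [/\ forall n, step (s_ n),
    forall t, s_ n t @[n --> \oo] --> f t &
    (\int[mu]_t (`|f t - s_ n t|)%:E)%E @[n --> \oo] --> 0%E].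
Proof.
move=> sf mb fb ib; have [r_ sr rf] := sf.
have b0 t : 0 <= b t by exact: le_trans (fb t).
pose A n := [set t | `|r_ n t - 0| <= 2 * b t].
have mA n : measurable (A n).
  rewrite -[A n]setTI; apply: measurable_fun_le => //.
    by apply: measurable_step_limit_dist; apply: step_step_limit => //; exact: step_cst.
  exact: measurable_funM.
exists (fun n t => if t \in A n then r_ n t else 0).
have ss n : step (fun t => if t \in A n then r_ n t else 0).
  apply: (@step_comp _ _ _ _ (fun p : bool * E => if p.1 then p.2 else 0)
    (fun t => (t \in A n, r_ n t))).
  by apply: step_pair => //; exact: step_mem.
have cs t : (if t \in A n then r_ n t else 0) @[n --> \oo] --> f t.
  have [f0|f0] := eqVneq (f t) 0.
    rewrite f0; apply/cvgr0Pnorm_lt => e e0.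
    have rf0 : r_ n t @[n --> \oo] --> (0 : E) by rewrite -f0; exact: rf.
    move/cvgr0Pnorm_lt : rf0 => /(_ e e0).
    by apply: filterS => n rn; case: ifP; rewrite ?normr0.
  apply: cvg_trans (rf t); apply: near_eq_cvg.
  have f0' : 0 < `|f t| by rewrite normr_gt0.
  have /cvgrPdist_le/(_ _ f0') := rf t.
  apply: filterS => n rn; rewrite mem_set// /A /= subr0.
  have := ler_distD (f t) (r_ n t) 0; rewrite !subr0 distrC; have := fb t; lra.
split=> //.
have -> : 0%E = (\int[mu]_(t in setT) (cst 0%E t))%E :> \bar R by rewrite integral0.
apply: (@dominated_cvg _ _ _ _ _ measurableT _ _ (fun t => (3 * b t)%:E)) => //.
- move=> n; apply/measurable_EFinP; apply: measurable_step_limit_dist => //.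
  exact: step_step_limit.
- move=> t _; apply: cvg_EFin; first exact: nearW.
  apply/cvgr0Pnorm_lt => e e0; have /cvgrPdist_lt/(_ e e0) := cs t.
  by apply: filterS => n; rewrite /= normr_id.
- under eq_fun do rewrite EFinM; exact: integrableZl.
- move=> n t _; rewrite abse_EFin normr_id lee_fin.
  case: ifPn => [/set_mem|_]; last by rewrite subr0; have := fb t; have := b0 t; lra.
  by rewrite /A /= subr0 => rn; have := ler_normB (f t) (r_ n t); have := fb t; lra.
Qed.

End bochner_integrals.

(** * Representable operators on L^1 *)

Lemma ae_forall_countable d (T : measurableType d) (R : realType)
  (mu : {measure set T -> \bar R}) (I : countType) (P : I -> T -> Prop) :
  (forall i, {ae mu, forall t, P i t}) -> {ae mu, forall t, forall i, P i t}.
Proof.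
move=> aeP; have H n : {ae mu, forall t, if unpickle n is Some i then P i t else True}.
  by case: unpickle => [i|]; [exact: aeP|exact: aeW].
by apply: filterS (ae_foralln H) => t Pt i; have := Pt (pickle i); rewrite pickleK.
Qed.

Section representable_operators.
Context {R : realType}.
Local Notation mu := (@lebesgue01 R).
Local Notation RT := (measurableTypeR R).

Lemma lebesgue01_lty : (mu setT < +oo)%E.
Proof.
rewrite /lebesgue01 /= /mrestr /= setTI lebesgue_measure_itv/= lte_fin ltr01.
by rewrite -EFinD ltry.
Qed.

Lemma L1_01_measurable (f : L1_01) :
  @measurable_fun _ _ RT RT setT (fun t => f t).
Proof. exact: Lspace_mfun. Qed.

Lemma L1_01_integrable (f : L1_01) : mu.-integrable setT (fun t : RT => (f t)%:E).
Proof. exact/Lfun1_integrable/Lspace_Lfun. Qed.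

Lemma L1_01_indic (A : set RT) : measurable A ->
  exists2 u : L1_01, {ae mu, forall t, u t = \1_A t} & `|u| = fine (mu A).
Proof.
move=> mA.
have iA : mu.-integrable setT (EFin \o (\1_A : RT -> R)).
  apply/integrableP; split.
    by apply/measurable_EFinP; exact: measurable_indic.
  rewrite (eq_integral (fun t => (\1_A t)%:E)); last first.
    by move=> t _; rewrite /= ger0_norm.
  by rewrite integral_indic// setIT finite_measure_lty// lebesgue01_lty.
have /Lfun1_integrable LA := iA.
pose u : L1_01 := Lspace_of (Lfun_Sub (lexx 1%E) LA).
have uA : {ae mu, forall t, u t = \1_A t}.
  by apply: filterS (Lspace_ofE (Lfun_Sub (lexx 1%E) LA)) => t /(_ I).
exists u => //; rewrite Lspace_normE.
rewrite (@ae_eq_Lnorm _ _ _ mu 1%E (lexx 1%E) u (\1_A)); last 3 first.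
- exact: Lspace_mfun.
- exact: measurable_indic.
- by apply: filterS uA => t.
rewrite Lnorm1 (eq_integral (fun t => (\1_A t)%:E)).
  by rewrite integral_indic// setIT.
by move=> t _; rewrite /= ger0_norm.
Qed.

Definition bochner_represents {E : normedModType R} (g : R -> E)
    (S : bounded_op L1_01 E) : Prop :=
  forall f : L1_01, is_bochner_integral mu (fun t => (f t : R) *: g t) (S f).

Lemma representable_step_limit {E : normedModType R} (S : bounded_op L1_01 E) :
  representable S -> exists2 g : RT -> E, step_limit g & bochner_represents g S.
Proof.
move=> [g [sg _ gS]]; have [h sh gh] := strongly_measurable_step_limit sg.
exists h => // f; apply: bochner_integral_ae_eq (gS f).
by apply: filterS gh => t ->.
Qed.

Lemma represents_comp {E F : normedModType R} (L : bounded_op E F) (g : R -> E)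
  (S : bounded_op L1_01 E) : bochner_represents g S ->
  bochner_represents (L \o g) (bounded_op_comp L S).
Proof.
move=> gS f; have := bochner_integral_linear lebesgue01_lty L (gS f).
by congr (is_bochner_integral _ _ _); apply/funext => t; rewrite /= linearZ.
Qed.

Lemma representable_comp {E F : normedModType R} (L : bounded_op E F)
  (S : bounded_op L1_01 E) : representable S -> representable (bounded_op_comp L S).
Proof.
have cL : continuous L by exact: bounded_op_continuous.
move=> [g [[s_ [ss sg]] [M gM] gS]]; exists (L \o g); split.
- exists (fun n => L \o s_ n); split=> [n|].
    apply: (step_simple_function lebesgue01_lty); apply: step_comp.
    exact: simple_function_step (ss n).
  by apply: filterS sg => t; apply: continuous_cvg; exact: cL.
- exists (`|L| * M); apply: filterS gM => t gt.
  by rewrite (le_trans (ler_opnorm _ _))// ler_wpM2l.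
- exact: represents_comp.
Qed.

Lemma nearly_representable_comp {E F : normedModType R} (L : bounded_op E F)
  (S : bounded_op L1_01 E) :
  nearly_representable S -> nearly_representable (bounded_op_comp L S).
Proof.
move=> nS D DD; have := representable_comp L (nS D DD).
by congr representable; exact: bounded_opP.
Qed.

Lemma represents_indic_dist_le {E : normedModType R} (g : RT -> E)
  (S : bounded_op L1_01 E) (A : set RT) (c : E) (e : R) (u : L1_01) :
  bochner_represents g S -> measurable A -> 0 <= e ->
  (forall t, A t -> `|g t - c| <= e) -> {ae mu, forall t, u t = \1_A t} ->
  `|S u - fine (mu A) *: c| <= e * fine (mu A).
Proof.
move=> gS mA e0 gc uA; rewrite -(simple_integral_indic lebesgue01_lty c mA).
have sA : step (fun t => if t \in A then c else 0).
  by apply: (@step_comp _ _ _ _ (fun b : bool => if b then c else 0)); exact: step_mem.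
have m1 : measurable_fun setT (\1_A : RT -> R) by exact: measurable_indic.
have intA : (\int[mu]_t (e * \1_A t)%:E = (e * fine (mu A))%:E)%E.
  under eq_integral do rewrite EFinM.
  rewrite ge0_integralZl//; last exact/measurable_EFinP.
  rewrite integral_indic// setIT EFinM fineK//.
  exact: (finite_measure_fin_num lebesgue01_lty).
rewrite -lee_fin -intA; apply: (bochner_integral_dist_le lebesgue01_lty (gS u)) => //.
- exact: measurable_funM.
- by move=> t; rewrite mulr_ge0.
apply: filterS uA => t ->; rewrite indicE.
by case: ifPn => [/set_mem/gc|_]; rewrite ?scale1r ?mulr1// scale0r subrr normr0 mulr0.
Qed.

(** Testing on the indicator of a set of positive measure on which every g i
    is nearly constant bounds the combination of these constants; countably
    many such sets cover the line. *)
Lemma represents_combination_le {E : normedModType R} n (g : 'I_n -> RT -> E)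
  (S : 'I_n -> bounded_op L1_01 E) (a : 'I_n -> R) (C : R) :
  (forall i, step_limit (g i)) -> (forall i, bochner_represents (g i) (S i)) ->
  (forall f, `|\sum_i a i *: S i f| <= C * `|f|) ->
  {ae mu, forall t, `|\sum_i a i *: g i t| <= C}.
Proof.
move=> sg gS SC.
have /choice[c cP] i := step_limit_dense (sg i).
pose A (e : R) (k : {ffun 'I_n -> nat}) : set RT :=
  \bigcap_(i : 'I_n) [set t | `|g i t - c i (k i)| <= e].
have mA e k : measurable (A e k).
  apply: fin_bigcap_measurable => // i _.
  rewrite -[X in measurable X]setTI; apply: measurable_fun_le => //.
  by apply: measurable_step_limit_dist => //; apply: step_step_limit; exact: step_cst.
have sum_le (e : R) (v : 'I_n -> E) : (forall i, `|v i| <= e) ->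
    `|\sum_i a i *: v i| <= (\sum_i `|a i|) * e.
  move=> ve; rewrite (le_trans (ler_norm_sum _ _ _))// mulr_suml.
  by apply: ler_sum => i _; rewrite normrZ ler_wpM2l.
have bound (m : nat) (k : {ffun 'I_n -> nat}) : {ae mu, forall t,
    A m.+1%:R^-1 k t -> `|\sum_i a i *: c i (k i)| <= C + (\sum_i `|a i|) * m.+1%:R^-1}.
  set e := m.+1%:R^-1; have e0 : 0 <= e by rewrite invr_ge0.
  have [A0|A0] := eqVneq (mu (A e k)) 0%E.
    exists (A e k); split=> // t /= h; apply: contrapT => At.
    by apply: h => /At.
  apply: aeW => t _; have [u uA un] := L1_01_indic (mA e k).
  set p := fine (mu (A e k)) in un.
  have p0 : 0 < p.
    rewrite fine_gt0// lt0e A0 measure_ge0/=.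
    exact: (finite_measure_lty lebesgue01_lty).
  have Sc i : `|S i u - p *: c i (k i)| <= e * p.
    by apply: (@represents_indic_dist_le _ (g i)) => // s; apply.
  rewrite -(ler_pM2l p0) -[X in X * `|_|]gtr0_norm// -normrZ scaler_sumr.
  have -> : \sum_i p *: (a i *: c i (k i)) =
      \sum_i a i *: S i u - \sum_i a i *: (S i u - p *: c i (k i)).
    rewrite -sumrB; apply: eq_bigr => i _.
    by rewrite scalerBr subKr !scalerA mulrC.
  rewrite (le_trans (ler_normB _ _))// mulrDr lerD//.
    by rewrite (le_trans (SC u))// un mulrC.
  by rewrite (le_trans (sum_le _ _ Sc))// mulrCA mulrC mulrAC mulrC.
have H := ae_foralln (fun m => ae_forall_countable (bound m)).
apply: filterS H => t Ht; rewrite -subr_le0.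
apply: (@le_epsilon_mul _ _ (2 * \sum_i `|a i|)) => [|e e0].
  by rewrite mulr_ge0// sumr_ge0.
have [m _ /(_ m (leqnn m))/= me] := near_infty_natSinv_lt (PosNum e0).
have m0 : 0 < m.+1%:R^-1 :> R by rewrite invr_gt0.
have /choice[k0 k0P] i := cP i t _ m0.
pose k := [ffun i => k0 i].
have := Ht m k; have kP i : `|g i t - c i (k i)| <= m.+1%:R^-1 by rewrite ffunE ltW.
move=> /(_ (fun i _ => kP i)) h1; have h2 := sum_le _ _ kP.
have h3 : (\sum_i `|a i|) * m.+1%:R^-1 <= (\sum_i `|a i|) * e.
  by rewrite ler_wpM2l// ?sumr_ge0// ltW.
have {h2} h2 := le_trans h2 h3.
have {h1 h3} h1 : `|\sum_i a i *: c i (k i)| <= C + (\sum_i `|a i|) * e.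
  by rewrite (le_trans h1)// lerD2l.
have : `|\sum_i a i *: g i t| <= `|\sum_i a i *: (g i t - c i (k i))| + `|\sum_i a i *: c i (k i)|.
  apply: le_trans (ler_normD _ _); rewrite -big_split/=.
  by under [in leRHS]eq_bigr do rewrite -scalerDr subrK.
lra.
Qed.

(** Boundedness of G makes f G integrable, hence an L^1 limit of step functions,
    whose integrals then converge to S f. *)
Lemma representable_of_dist_le {E : normedModType R} (G : RT -> E) (C : R)
  (S : bounded_op L1_01 E) : step_limit G -> (forall t, `|G t| <= C) ->
  (forall (f : L1_01) (s : RT -> E), step s ->
    (`|S f - simple_integral mu s|%:E <= \int[mu]_t (`|(f t : R) *: G t - s t|)%:E)%E) ->
  representable S.
Proof.
move=> sG GC dS; exists G; split.
- have [s_ ss sG'] := sG; exists s_; split=> [n|]; last exact: aeW.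
  exact: (step_simple_function lebesgue01_lty).
- by exists C; apply: aeW.
move=> f; have fm := L1_01_measurable f.
have C0 : 0 <= C by exact: le_trans (GC 0).
have [||||s_ [ss sf s0]] := @step_limit_L1_approx _ RT R mu E
    (fun t => (f t : R) *: G t) (fun t => C * `|f t|).
- exact: step_limitZ.
- by apply: measurable_funM => //; exact: measurableT_comp.
- by move=> t; rewrite normrZ mulrC ler_wpM2r.
- have := integrableZl measurableT C (integrable_abse (L1_01_integrable f)).
  by congr (mu.-integrable _ _); apply/funext => t /=; rewrite EFinM.
exists s_; split=> //.
- by move=> n; exact: (step_simple_function lebesgue01_lty).
- exact: aeW.
apply/cvgrPdist_lt => e e0; have := eventually_lt_of_cvg0 s0 e0.
apply: filterS => n; rewrite -lte_fin; exact: le_lt_trans (dS _ _ (ss n)).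
Qed.

End representable_operators.

(** * Evaluations and dense sequences in spaces of operators *)

Section evaluations.
Context {R : realType} {X Y : normedModType R}.

Let is_bounded_eval (x : X) : (fun S : bounded_op X Y => S x) \in is_bounded_op.
Proof.
apply/is_bounded_opP; split=> //.
by exists `|x| => S; rewrite mulrC ler_opnorm.
Qed.

Definition eval_op (x : X) : bounded_op (bounded_op X Y) Y :=
  BoundedOp (is_bounded_eval x).

Let is_bounded_val : (@compact_op_val R X Y) \in is_bounded_op.
Proof. by apply/is_bounded_opP; split=> //; exists 1 => S; rewrite mul1r. Qed.

Definition compact_incl : bounded_op (compact_op X Y) (bounded_op X Y) :=
  BoundedOp is_bounded_val.

Let is_bounded_postcomp (phi : dual_space Y) :
  (fun S : bounded_op X Y => bounded_op_comp phi S : dual_space X) \in is_bounded_op.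
Proof.
apply/is_bounded_opP; split.
  by move=> a S S'; apply: bounded_opP => x /=; rewrite linearP.
exists `|phi| => S; rewrite opnormE; apply: opnorm_le => [|x].
  by rewrite mulr_ge0.
by rewrite /= (le_trans (ler_opnorm _ _))// -mulrA ler_wpM2l// ler_opnorm.
Qed.

Definition postcomp_op (phi : dual_space Y) : bounded_op (bounded_op X Y) (dual_space X) :=
  BoundedOp (is_bounded_postcomp phi).

End evaluations.

Section dense_sequences.
Context {R : realType}.

Lemma separable_dense_seq (X : normedModType R) : separable X ->
  exists xs : nat -> X, forall x (e : R), 0 < e -> exists n, `|x - xs n| < e.
Proof.
move=> [A /countable_injP[f /in2W finj] dA].
have /choice[xs xsP] n : exists x, forall a, A a -> f a = n -> x = a.
  have [[a [Aa fa]]|h] := pselect (exists a, A a /\ f a = n).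
    by exists a => b Ab fb; apply: finj; rewrite ?inE// fa fb.
  by exists 0 => a Aa fa; exfalso; apply: h; exists a.
exists xs => x e e0; have [||a [/= xa Aa]] := dA (ball x e).
- by exists x; exact: ballxx.
- exact: ball_open.
by exists (f a); rewrite (xsP _ _ Aa erefl); move: xa; rewrite -ball_normE.
Qed.

Lemma norm_le_of_dense (X Y : normedModType R) (xs : nat -> X) (S : bounded_op X Y)
  (M : R) : (forall x (e : R), 0 < e -> exists n, `|x - xs n| < e) ->
  (forall n, `|xs n| <= 1 -> `|S (xs n)| <= M) -> `|S| <= M.
Proof.
move=> dxs SM; apply: ge_sup; first exact: (opnorm_has_sup S).1.
move=> _ [x /= x1 <-]; rewrite -subr_le0.
apply: (@le_epsilon_mul _ _ (2 * `|S|)) => [|e e0]; first by rewrite mulr_ge0.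
(* Shrinking x by a factor 1 - d leaves room for the approximating xs n in the
   unit ball. *)
pose d := Num.min e 1; have d0 : 0 < d by rewrite lt_min e0 ltr01.
have de : d <= e by rewrite ge_min lexx.
have d1 : d <= 1 by rewrite ge_min lexx orbT.
have [n xn] := dxs ((1 - d) *: x) d d0.
have nd : `|(1 - d) *: x| <= 1 - d.
  by rewrite normrZ ger0_norm ?ler_piMr// subr_ge0.
have n1 : `|xs n| <= 1.
  by have := ler_distD ((1 - d) *: x) (xs n) 0; rewrite !subr0 distrC; lra.
have xd : `|x - xs n| <= 2 * d.
  have : `|x - (1 - d) *: x| <= d.
    rewrite -{1}(scale1r x) -scalerBl subKr normrZ (gtr0_norm d0).
    by rewrite ler_piMr// ltW.
  by have := ler_distD ((1 - d) *: x) x (xs n); lra.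
have h1 : `|S x - S (xs n)| <= `|S| * (2 * d).
  by rewrite -linearB (le_trans (ler_opnorm _ _))// ler_wpM2l.
have h2 : `|S| * (2 * d) <= `|S| * (2 * e) by rewrite ler_wpM2l//; lra.
have := ler_distD (S (xs n)) (S x) 0; rewrite !subr0; have := SM n n1; lra.
Qed.

End dense_sequences.

(** * Comparison of densities *)

Section uniqueness.
Context {R : realType} {E : normedModType R}.
Local Notation mu := (@lebesgue01 R).
Local Notation RT := (measurableTypeR R).

Lemma represents_dist_le (g0 g1 g2 : RT -> E) (S0 S1 S2 : bounded_op L1_01 E) (a C : R) :
  step_limit g0 -> step_limit g1 -> step_limit g2 ->
  bochner_represents g0 S0 -> bochner_represents g1 S1 -> bochner_represents g2 S2 ->
  (forall f, `|S0 f - (a *: S1 f + S2 f)| <= C * `|f|) ->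
  {ae mu, forall t, `|g0 t - (a *: g1 t + g2 t)| <= C}.
Proof.
move=> s0 s1 s2 r0 r1 r2 SC.
pose g (i : 'I_3) : RT -> E := nth g0 [:: g0; g1; g2] i.
pose S (i : 'I_3) := nth S0 [:: S0; S1; S2] i.
pose b (i : 'I_3) : R := nth 1 [:: 1; - a; -1] i.
have E3 (v : 'I_3 -> E) : \sum_i b i *: v i =
    v ord0 - (a *: v (lift ord0 ord0) + v (lift ord0 (lift ord0 ord0))).
  rewrite !big_ord_recl big_ord0 /b/= scale1r scaleNr scaleN1r addr0.
  by rewrite opprD.
have H : {ae mu, forall t, `|\sum_i b i *: g i t| <= C}.
  apply: (@represents_combination_le R E 3 g S b C).
  - by case=> [[|[|[|]]]].
  - by case=> [[|[|[|]]]].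
  - by move=> f; rewrite E3; exact: SC.
by apply: filterS H => t; rewrite E3.
Qed.

Lemma represents_unique (g h : RT -> E) (S : bounded_op L1_01 E) :
  step_limit g -> step_limit h -> bochner_represents g S -> bochner_represents h S ->
  {ae mu, forall t, g t = h t}.
Proof.
move=> sg sh gS hS.
have [|N HN] := @represents_dist_le g h h S S S 0 0 sg sh sh gS hS hS.
  by move=> f; rewrite scale0r add0r subrr normr0 mul0r.
exists N; case: HN => mN N0 sN; split=> // t /= gh; apply: sN => /= h0.
by apply: gh; apply/eqP; rewrite -subr_eq0 -normr_le0; move: h0; rewrite scale0r add0r.
Qed.

End uniqueness.

(** * Measurability in operator norm *)

(** In this section G is a candidate density with values in K(X, Y), known only
    through the measurable functions t |-> G t (xs n); the range of d is dense
    in their values on Omega, phi (z, w) norms d z - d w, and h p is the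
    measurable function which agrees with t |-> phi p \o G t on Omega. *)
Section compact_valued_density.
Context {R : realType} {X Y : completeNormedModType R}.
Local Notation RT := (measurableTypeR R).
Variables (xs : nat -> X) (J : countType) (d : J -> Y).
Variables (phi : J * J -> dual_space Y).
Variables (G : RT -> compact_op X Y) (h : J * J -> RT -> dual_space X).
Variable Omega : set RT.
Hypothesis dxs : forall x (e : R), 0 < e -> exists n, `|x - xs n| < e.
Hypothesis mOmega : measurable Omega.
Hypothesis GOmega : forall t, ~ Omega t -> G t = 0.
Hypothesis sG : forall n, step_limit (fun t => G t (xs n)).
Hypothesis dG : forall n t (e : R), Omega t -> 0 < e -> exists z, `|G t (xs n) - d z| < e.
Hypothesis phi1 : forall p y, `|phi p y| <= `|y|.
Hypothesis phid : forall z w, phi (z, w) (d z - d w) = `|d z - d w|.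
Hypothesis sh : forall p, step_limit (h p).
Hypothesis hG : forall p t n, Omega t -> h p t (xs n) = phi p (G t (xs n)).

(** Only the countably many points xs n are tested, so that this set is
    measurable. *)
Let near_values (e : R) (l : seq J) : set RT := \bigcap_n
  (if `|xs n| <= 1 then \bigcup_(z in [set` l]) [set t | `|G t (xs n) - d z| <= e] else setT).

Let measurable_near_values e l : measurable (near_values e l).
Proof.
apply: bigcap_measurable => [|n _]; first by exists 0%N.
case: ifP => // _; apply: fin_bigcup_measurable => [|z _]; first exact: finite_seq.
rewrite -[X in measurable X]setTI; apply: measurable_fun_le => //.
by apply: measurable_step_limit_dist => //; apply: step_step_limit; exact: step_cst.
Qed.

(** The unit ball of X is mapped by G t into a compact subset of the closure of
    the range of d. *)
Let near_values_cover (e : R) t : Omega t -> 0 < e -> exists l, near_values e l t.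
Proof.
move=> Ot e0; have /is_compact_opP := valP (G t); rewrite precompactE.
set K := closure _ => cK; have e30 : 0 < e / 3 by rewrite divr_gt0.
have Kd y : K y -> exists z, `|y - d z| < e.
  move=> /(_ _ (nbhsx_ballx y _ e30))[_ [[x /= x1 <-]]].
  rewrite -ball_normE /= => yx.
  have e10 : 0 < e / 3 / (`|G t| + 1) by rewrite divr_gt0// ltr_wpDl.
  have [n xn] := dxs x e10; have [z nz] := dG n Ot e30; exists z.
  have xn' : `|G t x - G t (xs n)| <= e / 3.
    rewrite -linearB (le_trans (ler_opnorm _ _))//.
    rewrite (le_trans (ler_wpM2l _ (ltW xn)))// mulrCA ger_pMr//.
    by rewrite ler_pdivrMr ?ltr_wpDl// mul1r lerDl.
  have := ler_distD (G t x) y (d z); have := ler_distD (G t (xs n)) (G t x) (d z).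
  by rewrite (distrC y) in yx *; lra.
move: cK; rewrite compact_cover => /(_ J [set: J] (fun z => ball (d z) e)).
case=> [z _|y Ky|D _ KD]; first exact: ball_open.
  by have [z yz] := Kd y Ky; exists z => //; rewrite -ball_normE/= distrC.
exists (finmap.enum_fset D) => n _; case: ifPn => // n1.
have /KD[z zD zn] : K (G t (xs n)).
  by apply: subset_closure; exists (xs n).
by exists z => //; move: zn; rewrite -ball_normE/= distrC => /ltW.
Qed.

(** Let x be in the unit ball. If d z and d w are e-close to G t x and G u x,
    then applying phi (z, w), which norms d z - d w, gives
    |d z - d w| <= 2 e + |h (z, w) t - h (z, w) u| <= 4 e. *)
Let piece_dist_le (e : R) l t u : Omega t -> Omega u -> 0 <= e ->
  near_values e l t -> near_values e l u ->
  (forall z w, z \in l -> w \in l -> `|h (z, w) t - h (z, w) u| <= 2 * e) ->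
  `|G t - G u| <= 6 * e.
Proof.
move=> Ot Ou e0 nt nu hl.
apply: (@norm_le_of_dense R X Y xs (compact_op_val (G t - G u)) (6 * e)) => // n n1.
have := nt n I; rewrite n1 => -[z zl /= tz].
have := nu n I; rewrite n1 => -[w wl /= uw].
rewrite -[X in `|X|]/(G t (xs n) - G u (xs n)).
have hzw : `|phi (z, w) (G t (xs n)) - phi (z, w) (G u (xs n))| <= 2 * e.
  rewrite -!hG// -[X in `|X|]/((h (z, w) t - h (z, w) u) (xs n)).
  rewrite (le_trans (ler_opnorm _ _))// (le_trans _ (hl _ _ zl wl))//.
  by rewrite ler_piMr.
have hz : `|phi (z, w) (G t (xs n)) - phi (z, w) (d z)| <= e.
  by rewrite -linearB (le_trans (phi1 _ _)).
have hw : `|phi (z, w) (G u (xs n)) - phi (z, w) (d w)| <= e.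
  by rewrite -linearB (le_trans (phi1 _ _)).
have : `|d z - d w| <= 4 * e.
  rewrite -phid linearB.
  have a1 := ler_norm (phi (z, w) (d z) - phi (z, w) (d w)).
  have a2 := ler_distD (phi (z, w) (G t (xs n))) (phi (z, w) (d z)) (phi (z, w) (d w)).
  have a3 := ler_distD (phi (z, w) (G u (xs n))) (phi (z, w) (G t (xs n))) (phi (z, w) (d w)).
  by rewrite (distrC (phi _ (d z)) (phi _ (G t _))) in a2; lra.
have b1 := ler_distD (d z) (G t (xs n)) (G u (xs n)).
have b2 := ler_distD (d w) (d z) (G u (xs n)).
by rewrite (distrC (d w)) in b2; lra.
Qed.

(** A piece is labelled by a finite set l of indices of values of d, together
    with the indices of e-approximations of the functionals h (z, w) t for
    z, w in l. There are countably many labels, although neither K(X, Y) nor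
    X^* need be separable. *)
Lemma step_limit_compact_valued : step_limit G.
Proof.
have /choice[b bP] p := step_limit_dense (sh p).
pose pairs (l : seq J) := [seq (z, w) | z <- l, w <- l].
pose P (e : R) (c : option (seq J * seq nat)) : set RT :=
  if c is Some (l, ms) then
    Omega `&` near_values e l `&` \bigcap_(p in [set` pairs l])
      [set t | `|h p t - b p (nth 0%N ms (index p (pairs l)))| <= e]
  else ~` Omega.
have mP e c : measurable (P e c).
  case: c => [[l ms]|]; last exact: measurableC.
  apply: measurableI; first exact: measurableI.
  apply: fin_bigcap_measurable => [|p _]; first exact: finite_seq.
  rewrite -[X in measurable X]setTI; apply: measurable_fun_le => //.
  by apply: measurable_step_limit_dist => //; apply: step_step_limit; exact: step_cst.
have Pdiam e c t u : 0 <= e -> P e c t -> P e c u -> `|G t - G u| <= 6 * e.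
  move=> e0; case: c => [[l ms]|] /=.
    move=> [[Ot nt] ht] [[Ou nu] hu]; apply: (@piece_dist_le e l) => // z w zl wl.
    have zw : [set` pairs l] (z, w) by apply/allpairsP; exists (z, w).
    have htz := ht _ zw; have huz := hu _ zw.
    rewrite mulr_natl mulr2n; apply: le_trans (ler_distD _ _ _) (lerD htz _).
    by rewrite distrC.
  by move=> /GOmega -> /GOmega ->; rewrite subrr normr0 mulr_ge0.
have Pcover e t : 0 < e -> exists c, P e c t.
  move=> e0; have [Ot|nOt] := pselect (Omega t); last by exists None.
  have [l nl] := near_values_cover Ot e0.
  have /choice[m mP'] p := bP p t e e0.
  exists (Some (l, [seq m p | p <- pairs l])); split=> // p pl /=.
  by rewrite (nth_map p) ?index_mem// nth_index// ltW.
apply: step_limit_of_covers => e e0.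
have e60 : 0 < e / 6 by rewrite divr_gt0.
exists (fun k => if unpickle k is Some c then P (e / 6) c else set0); split.
- by move=> k; case: unpickle.
- by move=> t; have [c Pc] := Pcover _ t e60; exists (pickle c); rewrite pickleK.
- move=> k t u; case: unpickle => // c Pt Pu.
  by have := Pdiam _ _ _ _ (ltW e60) Pt Pu; lra.
Qed.

End compact_valued_density.

Theorem theorem4 (R : realType) (X Y : completeNormedModType R)
  (X_separable : separable X)
  (dualX_nearRNP : near_RNP (dual_space X))
  (Y_nearRNP : near_RNP Y)
  (L_eq_K : forall T : bounded_op X Y, T \in is_compact_op) :
  near_RNP (compact_op X Y).
Proof.
move=> T nT.
have [xs dxs] := separable_dense_seq X_separable.
pose T' : bounded_op L1_01 (bounded_op X Y) := bounded_op_comp compact_incl T.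
have nT' : nearly_representable T' by exact: nearly_representable_comp.
have evT n : exists g : measurableTypeR R -> Y, step_limit g /\
    bochner_represents g (bounded_op_comp (eval_op (xs n)) T').
  have [g sg gT] := representable_step_limit (Y_nearRNP _
    (nearly_representable_comp (eval_op (xs n)) nT')); by exists g.
have {evT}/choice[g gP] := evT.
have sg n := (gP n).1; have gT n := (gP n).2.
have /choice[c cP] n := step_limit_dense (sg n).
pose d (z : nat * nat) := c z.1 z.2.
have /choice[phi phiP] (p : (nat * nat) * (nat * nat)) := norming_functional (d p.1 - d p.2).
have postT p : exists h : measurableTypeR R -> dual_space X, step_limit h /\
    bochner_represents h (bounded_op_comp (postcomp_op (phi p)) T').
  have [h sh hT] := representable_step_limit (dualX_nearRNP _
    (nearly_representable_comp (postcomp_op (phi p)) nT')); by exists h.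
have {postT}/choice[h hP] := postT.
have sh p := (hP p).1; have hT p := (hP p).2.
have gT_lin (q : rat) i j k : {ae lebesgue01, forall t,
    `|g k t - (ratr q *: g i t + g j t)| <= `|T| * `|xs k - (ratr q *: xs i + xs j)|}.
  apply: (represents_dist_le (sg k) (sg i) (sg j) (gT k) (gT i) (gT j)) => f.
  have TE : T f (xs k - (ratr q *: xs i + xs j)) =
      T f (xs k) - (ratr q *: T f (xs i) + T f (xs j)).
    by rewrite linearB linearD linearZ.
  rewrite -[X in `|X|]/(T f (xs k) - (ratr q *: T f (xs i) + T f (xs j))) -TE.
  rewrite (le_trans (ler_opnorm (compact_op_val (T f)) _))//.
  by rewrite mulrAC ler_wpM2r//; exact: (ler_opnorm T f).
have hg p n : {ae lebesgue01, forall t, h p t (xs n) = phi p (g n t)}.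
  have cphi : continuous (phi p) by exact: bounded_op_continuous.
  have cev : continuous (@eval_op R X R^o (xs n)) by exact: bounded_op_continuous.
  apply: (@represents_unique R R^o (@eval_op R X R^o (xs n) \o h p) (phi p \o g n)
    (bounded_op_comp (@eval_op R X R^o (xs n)) (bounded_op_comp (postcomp_op (phi p)) T'))).
  - exact: step_limit_comp.
  - exact: step_limit_comp.
  - exact: represents_comp.
  - have := represents_comp (phi p) (gT n).
    by congr bochner_represents; exact: bounded_opP.
have H1 := ae_forall_countable (fun w : rat * (nat * nat * nat) =>
  gT_lin w.1 w.2.1.1 w.2.1.2 w.2.2).
have H2 := ae_forall_countable (fun w : (nat * nat) * (nat * nat) * nat => hg w.1 w.2).
have [N [mN N0 sN]] := filterI H1 H2.
have good t : ~ N t -> (forall (q : rat) i j k, `|g k t - (ratr q *: g i t + g j t)| <=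
      `|T| * `|xs k - (ratr q *: xs i + xs j)|) /\
    forall p n, h p t (xs n) = phi p (g n t).
  move=> Nt; apply: contrapT => nH; apply: Nt; apply: sN => -[H1t H2t]; apply: nH.
  by split=> [q i j k|p n]; [exact: (H1t (q, (i, j, k)))|exact: (H2t (p, n))].
(* Putting G t = 0 on N makes each t |-> G t (xs n) a limit of step functions
   everywhere. *)
have /choice[G GP] t : exists S : compact_op X Y, (N t -> S = 0) /\
    (~ N t -> (forall n, S (xs n) = g n t) /\ forall x, `|S x| <= `|T| * `|x|).
  have [Nt|Nt] := pselect (N t); first by exists 0.
  have [S Sg Sn] := dense_extension (normr_ge0 T) dxs (good t Nt).1.
  by exists (CompactOp (L_eq_K S)); split=> // _; split.
have GE n t : ~ N t -> G t (xs n) = g n t by move=> /(GP t).2[].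
have sG : step_limit G.
  apply: (@step_limit_compact_valued R X Y xs _ d phi G h (~` N)) => //.
  - exact: measurableC.
  - by move=> t /notP Nt; apply: (GP t).1.
  - move=> n; have := step_limitZ (measurable_indic (measurableC mN)) (sg n).
    congr step_limit; apply/funext => t; rewrite indicE.
    have [Nt|Nt] := pselect (N t); last by rewrite GE// mem_set// scale1r.
    by rewrite memNset ?scale0r; [rewrite (GP t).1|move=> /(_ Nt)].
  - by move=> n t e Nt e0; rewrite GE//; have [k nk] := cP n t e e0; exists (n, k).
  - by move=> p y; have [h1 _] := phiP p; exact: h1.
  - by move=> z w; have [_] := phiP (z, w).
  - by move=> p t n Nt; rewrite GE//; exact: (good t Nt).2.
apply: (representable_of_dist_le (C := `|T|) sG) => [t|f s ss].
  rewrite compact_op_normE opnormE; apply: opnorm_le => // x.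
  have [/(GP t).1 ->|Nt] := pselect (N t); last by have [_ ->] := (GP t).2 Nt.
  by rewrite [X in `|X|](_ : _ = 0)// normr0 mulr_ge0.
have [->|fin] := eqVneq (\int[lebesgue01]_t (`|(f t : R) *: G t - s t|)%:E)%E +oo%E.
  exact: leey.
have fin' : (\int[lebesgue01]_t (`|(f t : R) *: G t - s t|)%:E)%E \is a fin_num.
  by rewrite ge0_fin_numE ?ltey// integral_ge0// => t _; rewrite lee_fin.
rewrite -(fineK fin') lee_fin.
apply: (@norm_le_of_dense R X Y xs (compact_op_val (T f - simple_integral lebesgue01 s)))
  => // n n1.
pose L := bounded_op_comp (eval_op (xs n)) (@compact_incl R X Y).
rewrite -[X in `|X|]/(bounded_op_comp (eval_op (xs n)) T' f - L (simple_integral lebesgue01 s)).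
rewrite -(simple_integral_linear lebesgue01_lty)// -lee_fin fineK//.
apply: (bochner_integral_dist_le lebesgue01_lty (gT n f)) => //.
- exact: step_comp.
- apply: measurable_step_limit_dist; last exact: step_step_limit.
  by apply: step_limitZ => //; exact: L1_01_measurable.
- exists N; split=> // t /= H; apply: contrapT => Nt; apply: H.
  rewrite -GE// -[X in `|X|]/(L ((f t : R) *: G t - s t)).
  rewrite (le_trans (ler_opnorm (compact_op_val ((f t : R) *: G t - s t)) (xs n)))//.
  by rewrite ler_piMr.
Qed.
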